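(* Let $n\ge 1$ and let $\alpha,\gamma,\delta>0$ be real parameters. (1) There is a Riemannian metric $ds^2_{\mathcal{X}^J_n}$ on the Siegel-Jacobi upper half space $\mathcal{X}^J_n$ which is invariant under the action of $G^J_n(\mathbb{R})_0$, and which has the following expressions in the three coordinate systems $(x,y,p,q)$, $(x,y,\chi,\psi)$, $(x,y,\xi,\rho)$: $$ds_{\mathcal{X}^J_n}^2(x,y,p,q)=\alpha\,\mathrm{tr}\big[(y^{-1}dx)^2+(y^{-1}dy)^2\big]+\gamma\big[dp\,(xy^{-1}x+yy^{-1}y)\,dp^t+dq\,y^{-1}dq^t+2\,dp\,xy^{-1}dq^t\big];$$ $$ds_{\mathcal{X}^J_n}^2(x,y,\chi,\psi)=\alpha\,\mathrm{tr}\big[(y^{-1}dx)^2+(y^{-1}dy)^2\big]+\gamma\big[d\psi^t(xy^{-1}x+yy^{-1}y)\,d\psi+d\chi^t y^{-1}d\chi+2\,d\psi^t xy^{-1}d\chi\big];$$ $$\begin{aligned}ds_{\mathcal{X}^J_n}^2(x,y,\xi,\rho)=\;&\alpha\,\mathrm{tr}\big[(y^{-1}dx)^2+(y^{-1}dy)^2\big]\\&+\gamma\big[d\xi\,y^{-1}d\xi^t+d\rho\,y^{-1}d\rho^t+\rho y^{-1}dx\,y^{-1}(\rho y^{-1}dx)^t+\rho y^{-1}dy\,y^{-1}(\rho y^{-1}dy)^t\\&\qquad-2\rho y^{-1}dx\,y^{-1}d\xi^t-2\rho y^{-1}dy\,y^{-1}d\rho^t\big].\end{aligned}$$ (2) The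 following is a three-parameter Riemannian metric on the extended Siegel-Jacobi upper half space $\tilde{\mathcal{X}}^J_n\approx\mathcal{X}^J_n\times\mathbb{R}$, with coordinates $(x,y,p,q,\kappa)$, which is invariant under the action of $G^J_n(\mathbb{R})$: $$\begin{aligned}ds_{\tilde{\mathcal{X}}^J_n}^2(x,y,p,q,\kappa)=\;&ds_{\mathcal{X}^J_n}^2(x,y,p,q)+\delta\,(d\kappa-p\,dq^t+q\,dp^t)^2\\=\;&\alpha\,\mathrm{tr}\big[(y^{-1}dx)^2+(y^{-1}dy)^2\big]\\&+\gamma\big[dp\,(xy^{-1}x+yy^{-1}y)\,dp^t+dq\,y^{-1}dq^t+2\,dp\,xy^{-1}dq^t\big]\\&+\delta\,(d\kappa-p\,dq^t+q\,dp^t)^2.\end{aligned}$$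
   Context: $M(m,n,\mathbb{F})$ is the set of $m\times n$ matrices over $\mathbb{F}$; $A^t$ is the transpose. $\mathrm{Sp}(n,\mathbb{R})$ is the group of real $2n\times2n$ matrices $M=\begin{pmatrix}a&b\\c&d\end{pmatrix}$ ($a,b,c,d\in M(n,n,\mathbb{R})$) with $M^tJM=J$, $J=\begin{pmatrix}0&1_n\\-1_n&0\end{pmatrix}$. Real Jacobi group: $G^J_n(\mathbb{R})$ is the set of triples $(M,(\lambda,\mu),\kappa)$, $M\in\mathrm{Sp}(n,\mathbb{R})$, $\lambda,\mu\in M(1,n,\mathbb{R})$, $\kappa\in\mathbb{R}$, with composition law $(M,(\lambda,\mu),\kappa)(M',(\lambda',\mu'),\kappa')=(MM',(\tilde\lambda+\lambda',\tilde\mu+\mu'),\kappa+\kappa'+\tilde\lambda\mu'^t-\tilde\mu\lambda'^t)$, where $(\tilde\lambda,\tilde\mu)=(\lambda,\mu)M'$. The restricted group $G^J_n(\mathbb{R})_0$ consists of the pairs $(M,(\lambda,\mu))$ with the law obtained by forgetting $\kappa$. Siegel upper half space: $\mathcal{X}_n=\{v=x+iy: x,y\in M(n,n,\mathbb{R}),\ x=x^t,\ y=y^t,\ y>0\}$. Siegel-Jacobi upper half space: $\mathcal{X}^J_n=G^J_n(\mathbb{R})/(\mathrm{U}(n)\times\mathbb{R})$, realized as the set of pairs $(v,u)$ with $v\in\mathcal{X}_n$, $u\in M(1,n,\mathbb{C})$. Extended Siegel-Jacobi upper half space: $\tilde{\mathcal{X}}^J_n=G^J_n(\mathbb{R})/\mathrm{U}(n)$,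 realized as the set of triples $(v,u,\kappa)$ with $(v,u)\in\mathcal{X}^J_n$, $\kappa\in\mathbb{R}$. Coordinates on $\mathcal{X}^J_n$: $v=x+iy$ and $u=pv+q=\xi+i\rho$ with $p,q,\xi,\rho\in M(1,n,\mathbb{R})$, so $\xi=px+q$, $\rho=py$; and $\psi=p^t$, $\chi=q^t\in M(n,1,\mathbb{R})$. Actions: $(M,(\lambda,\mu))\in G^J_n(\mathbb{R})_0$ sends $(v',u')\in\mathcal{X}^J_n$ to $(v_1,u_1)$ with $v_1=(av'+b)(cv'+d)^{-1}$, $u_1=(u'+\lambda v'+\mu)(cv'+d)^{-1}$; equivalently, in coordinates, with $(p,q):=(\lambda,\mu)M^{-1}$ attached to the group element, $(p_1,q_1)=(p,q)+(p',q')M^{-1}$. The element $(M,(\lambda,\mu),\kappa)\in G^J_n(\mathbb{R})$ sends $(v',u',\kappa')\in\tilde{\mathcal{X}}^J_n$, where $u'=p'v'+q'$, to $(v_1,u_1,\kappa_1)$ with $v_1,u_1$ as just given and $\kappa_1=\kappa+\kappa'+\lambda q'^t-\mu p'^t$. In all expressions $dx,dy,dp,\dots$ are matrices of differentials, and products of differentials are symmetric products (so these are quadratic differential forms). *)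

(* Defs.v *)
(* MathComp / MathComp-Analysis *)
From mathcomp Require Import all_boot all_order all_algebra.
From mathcomp Require Import all_classical all_reals all_analysis.
From mathcomp Require Import complex.

Set Implicit Arguments.
Unset Strict Implicit.
Unset Printing Implicit Defensive.

Import Order.TTheory GRing.Theory Num.Theory.
Import numFieldNormedType.Exports.

Local Open Scope classical_set_scope.
Local Open Scope complex_scope.
Local Open Scope ring_scope.

(** * Calculus on a relatively open subset [A] of a linear subspace [V]

    The spaces below are cut out of spaces of pairs of square matrices by
    symmetry conditions, hence are open only in a proper linear subspace [V],
    which is then the tangent space at each point.  Derivatives are taken only
    along [V]: for z in A and w in V, z + h w stays in A for small h. *)

(* C^k: all iterated directional derivatives along V up to order k exist and
   are continuous on A. *)
Fixpoint Ck_on (R : realType) (E F : normedModType R) (V A : set E) (k : nat)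
    (f : E -> F) : Prop :=
  {within A, continuous f} /\
  if k is k'.+1 then
    forall w, V w ->
      (forall z, A z -> derivable f z w) /\ Ck_on V A k' (fun z => 'D_w f z)
  else True.

Definition smooth_on (R : realType) (E F : normedModType R) (V A : set E)
    (f : E -> F) : Prop := forall k, Ck_on V A k f.

(* Only the values g z w1 w2 with z in A and w1, w2 in V are meaningful.
   Smoothness is that of the coefficients in constant frames of V. *)
Definition riemannian_metric (R : realType) (E : normedModType R)
    (V A : set E) (g : E -> E -> E -> R) : Prop :=
  [/\ forall z w1 w2, A z -> V w1 -> V w2 -> g z w1 w2 = g z w2 w1,
      forall z (a : R) w1 w2 w3, A z -> V w1 -> V w2 -> V w3 ->
        g z (a *: w1 + w2) w3 = a * g z w1 w3 + g z w2 w3,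
      forall z w, A z -> V w -> w != 0 -> 0 < g z w w
    & forall w1 w2, V w1 -> V w2 ->
        smooth_on V A (fun z => g z w1 w2 : R^o)].

Definition pullback (R : realType) (E F : normedModType R) (f : E -> F)
    (g : F -> F -> F -> R) : E -> E -> E -> R :=
  fun z w1 w2 => g (f z) ('D_w1 f z) ('D_w2 f z).

Definition isometry_on (R : realType) (E : normedModType R) (V A : set E)
    (g : E -> E -> E -> R) (f : E -> E) : Prop :=
  [/\ forall z, A z -> A (f z),
      forall z w, A z -> V w -> derivable f z w
    & forall z w1 w2, A z -> V w1 -> V w2 ->
        pullback f g z w1 w2 = g z w1 w2].

(* [Q z dz] is the quadratic differential form ds^2 in the coordinates z given
   by the parametrization f, z ranging over A and dz over V. *)
Definition expressed_as (R : realType) (E F : normedModType R) (V A : set E)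
    (f : E -> F) (g : F -> F -> F -> R) (Q : E -> E -> R) : Prop :=
  (forall z dz, A z -> V dz -> derivable f z dz) /\
  (forall z dz, A z -> V dz -> pullback f g z dz dz = Q z dz).

(** * Matrices *)

Definition symmetric (R : realType) (n : nat) (y : 'M[R]_n) : Prop := y^T = y.

Definition posdef (R : realType) (n : nat) (y : 'M[R]_n) : Prop :=
  forall r : 'rV[R]_n, r != 0 -> 0 < (r *m y *m r^T) 0 0.

Definition cplx_mx (R : realType) (m n : nat) (A : 'M[R]_(m, n)) :
  'M[R[i]]_(m, n) := map_mx (fun t : R => t%:C) A.

Definition re_mx (R : realType) (m n : nat) (A : 'M[R[i]]_(m, n)) :
  'M[R]_(m, n) := map_mx (@complex.Re R) A.

Definition im_mx (R : realType) (m n : nat) (A : 'M[R[i]]_(m, n)) :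
  'M[R]_(m, n) := map_mx (@complex.Im R) A.

(** * The Jacobi groups *)

Definition J_mx (R : realType) (n : nat) : 'M[R]_(n + n) :=
  block_mx 0 1%:M (- 1%:M) 0.

Definition Sp (R : realType) (n : nat) : set 'M[R]_(n + n) :=
  [set M | M^T *m J_mx R n *m M = J_mx R n].

(* (M, (lambda, mu)) *)
Definition jacobi0_elt (R : realType) (n : nat) : Type :=
  ('M[R]_(n + n) * ('rV[R]_n * 'rV[R]_n))%type.

(* ((M, (lambda, mu)), kappa) *)
Definition jacobi_elt (R : realType) (n : nat) : Type :=
  (jacobi0_elt R n * R)%type.

Definition GJ0 (R : realType) (n : nat) : set (jacobi0_elt R n) :=
  [set h | Sp h.1].

Definition GJ (R : realType) (n : nat) : set (jacobi_elt R n) :=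
  [set h | GJ0 h.1].

Definition jacobi0_mul (R : realType) (n : nat) (h h' : jacobi0_elt R n) :
    jacobi0_elt R n :=
  let lm := row_mx h.2.1 h.2.2 *m h'.1 in
  (h.1 *m h'.1, (lsubmx lm + h'.2.1, rsubmx lm + h'.2.2)).

Definition jacobi_mul (R : realType) (n : nat) (h h' : jacobi_elt R n) :
    jacobi_elt R n :=
  let lm := row_mx h.1.2.1 h.1.2.2 *m h'.1.1 in
  (jacobi0_mul h.1 h'.1,
   h.2 + h'.2 + (lsubmx lm *m h'.1.2.2^T - rsubmx lm *m h'.1.2.1^T) 0 0).

(** * The Siegel-Jacobi upper half spaces *)

(* (v, u) *)
Definition sj_pt (R : realType) (n : nat) : Type :=
  ('M[R[i]]_n * 'rV[R[i]]_n)%type.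

Definition siegel (R : realType) (n : nat) : set 'M[R[i]]_n :=
  [set v | [/\ symmetric (re_mx v), symmetric (im_mx v) & posdef (im_mx v)]].

Definition siegel_jacobi (R : realType) (n : nat) : set (sj_pt R n) :=
  [set z | siegel z.1].

(* Meaningful for M in Sp and v in the Siegel space, where c v + d is
   invertible. *)
Definition act0_cplx (R : realType) (n : nat) (h : jacobi0_elt R n)
    (z : sj_pt R n) : sj_pt R n :=
  let: (M, (l, m)) := h in
  let: (v, u) := z in
  let a := cplx_mx (ulsubmx M) in
  let b := cplx_mx (ursubmx M) in
  let c := cplx_mx (dlsubmx M) in
  let d := cplx_mx (drsubmx M) in
  let D := invmx (c *m v + d) in
  ((a *m v + b) *m D, (u + cplx_mx l *m v + cplx_mx m) *m D).

(* The real p, q with u = p v + q, i.e. Re u = p x + q and Im u = p y. *)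
Definition p_of (R : realType) (n : nat) (z : sj_pt R n) : 'rV[R]_n :=
  im_mx z.2 *m invmx (im_mx z.1).

Definition q_of (R : realType) (n : nat) (z : sj_pt R n) : 'rV[R]_n :=
  re_mx z.2 - p_of z *m re_mx z.1.

Definition act_cplx (R : realType) (n : nat) (h : jacobi_elt R n)
    (z : sj_pt R n * R) : sj_pt R n * R :=
  let: (M, (l, m), k) := h in
  (act0_cplx h.1 z.1,
   k + z.2 + (l *m (q_of z.1)^T - m *m (p_of z.1)^T) 0 0).

(** * Real coordinates

    All coordinate systems have the form (x, y, s, t), with x and y the real
    and imaginary parts of v and s, t two real row or column vectors.  The
    system (x, y, xi, rho) -- real and imaginary parts of v and of u -- serves
    as the model of the manifold: metrics and actions are transported to it. *)

Definition row_coords (R : realType) (n : nat) : normedModType R :=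
  ('M[R]_n * 'M[R]_n * 'rV[R]_n * 'rV[R]_n)%type.

Definition col_coords (R : realType) (n : nat) : normedModType R :=
  ('M[R]_n * 'M[R]_n * 'cV[R]_n * 'cV[R]_n)%type.

Definition param_xirho (R : realType) (n : nat) (z : row_coords R n) :
    sj_pt R n :=
  let: (x, y, xi, rho) := z in
  (cplx_mx x + 'i%C *: cplx_mx y, cplx_mx xi + 'i%C *: cplx_mx rho).

Definition coords_xirho (R : realType) (n : nat) (z : sj_pt R n) :
    row_coords R n :=
  (re_mx z.1, im_mx z.1, re_mx z.2, im_mx z.2).

Definition param_pq (R : realType) (n : nat) (z : row_coords R n) :
    sj_pt R n :=
  let: (x, y, p, q) := z in
  let v := cplx_mx x + 'i%C *: cplx_mx y in
  (v, cplx_mx p *m v + cplx_mx q).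

Definition param_chipsi (R : realType) (n : nat) (z : col_coords R n) :
    sj_pt R n :=
  let: (x, y, chi, psi) := z in param_pq (x, y, psi^T, chi^T).

(* Coordinate domains are preimages of the Siegel-Jacobi space under the
   parametrizations; tangent directions are those with dx and dy symmetric. *)
Definition row_tangent (R : realType) (n : nat) : set (row_coords R n) :=
  [set w | let: (dx, dy, _, _) := w in symmetric dx /\ symmetric dy].

Definition col_tangent (R : realType) (n : nat) : set (col_coords R n) :=
  [set w | let: (dx, dy, _, _) := w in symmetric dx /\ symmetric dy].

Definition dom_xirho (R : realType) (n : nat) : set (row_coords R n) :=
  @param_xirho R n @^-1` @siegel_jacobi R n.

Definition dom_pq (R : realType) (n : nat) : set (row_coords R n) :=
  @param_pq R n @^-1` @siegel_jacobi R n.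

Definition dom_chipsi (R : realType) (n : nat) : set (col_coords R n) :=
  @param_chipsi R n @^-1` @siegel_jacobi R n.

Definition act0 (R : realType) (n : nat) (h : jacobi0_elt R n)
    (z : row_coords R n) : row_coords R n :=
  coords_xirho (act0_cplx h (param_xirho z)).

Definition xirho_of_xirho (R : realType) (n : nat) (z : row_coords R n) :
    row_coords R n := coords_xirho (param_xirho z).

Definition xirho_of_pq (R : realType) (n : nat) (z : row_coords R n) :
    row_coords R n := coords_xirho (param_pq z).

Definition xirho_of_chipsi (R : realType) (n : nat) (z : col_coords R n) :
    row_coords R n := coords_xirho (param_chipsi z).

(* Extended space: one more real coordinate kappa. *)

Definition ext_coords (R : realType) (n : nat) : normedModType R :=
  (row_coords R n * R^o)%type.

Definition ext_tangent (R : realType) (n : nat) : set (ext_coords R n) :=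
  [set w | row_tangent w.1].

Definition ext_dom_xirho (R : realType) (n : nat) : set (ext_coords R n) :=
  [set z | dom_xirho z.1].

Definition ext_dom_pq (R : realType) (n : nat) : set (ext_coords R n) :=
  [set z | dom_pq z.1].

Definition ext_act (R : realType) (n : nat) (h : jacobi_elt R n)
    (z : ext_coords R n) : ext_coords R n :=
  let z1 := act_cplx h (param_xirho z.1, z.2) in (coords_xirho z1.1, z1.2).

Definition ext_xirho_of_pq (R : realType) (n : nat) (z : ext_coords R n) :
    ext_coords R n := (xirho_of_pq z.1, z.2).

(** * The quadratic differential forms *)

Definition ds2_siegel (R : realType) (n : nat) (x y dx dy : 'M[R]_n) : R :=
  let iy := invmx y in
  \tr ((iy *m dx) *m (iy *m dx) + (iy *m dy) *m (iy *m dy)).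

Definition ds2_pq (R : realType) (n : nat) (alpha gamma : R)
    (z dz : row_coords R n) : R :=
  let: (x, y, p, q) := z in
  let: (dx, dy, dp, dq) := dz in
  let iy := invmx y in
  alpha * ds2_siegel x y dx dy
  + gamma * (dp *m (x *m iy *m x + y *m iy *m y) *m dp^T
             + dq *m iy *m dq^T
             + 2 *: (dp *m x *m iy *m dq^T)) 0 0.

Definition ds2_chipsi (R : realType) (n : nat) (alpha gamma : R)
    (z dz : col_coords R n) : R :=
  let: (x, y, chi, psi) := z in
  let: (dx, dy, dchi, dpsi) := dz in
  let iy := invmx y in
  alpha * ds2_siegel x y dx dy
  + gamma * (dpsi^T *m (x *m iy *m x + y *m iy *m y) *m dpsi
             + dchi^T *m iy *m dchi
             + 2 *: (dpsi^T *m x *m iy *m dchi)) 0 0.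

Definition ds2_xirho (R : realType) (n : nat) (alpha gamma : R)
    (z dz : row_coords R n) : R :=
  let: (x, y, xi, rho) := z in
  let: (dx, dy, dxi, drho) := dz in
  let iy := invmx y in
  alpha * ds2_siegel x y dx dy
  + gamma * (dxi *m iy *m dxi^T + drho *m iy *m drho^T
             + rho *m iy *m dx *m iy *m (rho *m iy *m dx)^T
             + rho *m iy *m dy *m iy *m (rho *m iy *m dy)^T
             - 2 *: (rho *m iy *m dx *m iy *m dxi^T)
             - 2 *: (rho *m iy *m dy *m iy *m drho^T)) 0 0.

(* d kappa - p dq^t + q dp^t *)
Definition contact_form (R : realType) (n : nat) (z dz : ext_coords R n) : R :=
  let: (x, y, p, q, kappa) := z in
  let: (dx, dy, dp, dq, dkappa) := dz in
  dkappa - (p *m dq^T) 0 0 + (q *m dp^T) 0 0.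

Definition ds2_ext (R : realType) (n : nat) (alpha gamma delta : R)
    (z dz : ext_coords R n) : R :=
  let: (x, y, p, q, kappa) := z in
  let: (dx, dy, dp, dq, dkappa) := dz in
  let iy := invmx y in
  alpha * ds2_siegel x y dx dy
  + gamma * (dp *m (x *m iy *m x + y *m iy *m y) *m dp^T
             + dq *m iy *m dq^T
             + 2 *: (dp *m x *m iy *m dq^T)) 0 0
  + delta * (dkappa - (p *m dq^T) 0 0 + (q *m dp^T) 0 0) ^+ 2.

(* Main.v *)
(* With [u = p v + q], the 1-form [eta = du - p dv = dp v + dq] is covariant: an
   element with blocks [a b; c d] multiplies it on the right by
   [D = (c v + d)^-1], while [dv] becomes [D^T dv D] and [y^-1] becomes
   [(c v + d) y^-1 (c v + d)^*].  Hence [tr (y^-1 dv y^-1 (dv)^* )] and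
   [eta y^-1 eta^*] are invariant, and the two of them give the metric.  The
   form [d kappa - p dq^t + q dp^t] is invariant because [(p, q)] and [(dp, dq)]
   both transform by the symplectic matrix [M^-1], up to a translation of
   [(p, q)] that the transformation of [kappa] compensates.

   Only real matrices are ever inverted: [(c v + d) y^-1 (c v + d)^*] is a real
   matrix [S], so that [(c v + d)^-1 = y^-1 (c v + d)^* S^-1].  The derivative
   of the action follows from
   [N_t W_t^-1 = N_0 W_0^-1 + t (N_1 - N_0 W_0^-1 W_1) W_t^-1] for
   [N_t = N_0 + t N_1] and [W_t = W_0 + t W_1]. *)
Require Import Defs.
From mathcomp Require Import all_boot all_order all_algebra.
From mathcomp Require Import all_classical all_reals all_analysis.
From mathcomp Require Import complex ring.
Import Order.TTheory GRing.Theory Num.Theory.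
Import numFieldNormedType.Exports.
Local Open Scope classical_set_scope.
Local Open Scope ring_scope.

Set Implicit Arguments.
Unset Strict Implicit.
Unset Printing Implicit Defensive.

(** * Calculus of matrix-valued functions *)

(** Positivity, limits and smoothness concern real matrices, whereas invariance is a congruence by
    the complex matrix [D]. The two forms are therefore defined through real and imaginary parts and
    polarised; they are rewritten as real parts of Hermitian expressions only where [D] has to be
    cancelled.

    Symmetry of [x] and [y] keeps the domain from being open in the coordinate space. Smoothness of
    the coefficients is proved in all directions on the open set where [y] is invertible, and then
    restricted.

    Definiteness rests on [tr (B A B A)] being a squared norm for [B = y^-1] and symmetric [A]: with
    [B = L L^T] it is the Frobenius norm of [L^T A L], squared. This is the reason for the Cholesky
    factorisation.

    The pair [(dp, dq)] is defined algebraically as the coordinates of [eta], so its transformation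
    law follows from that of [eta] by uniqueness of real coordinates. That it is the differential of
    [(p, q)] is established where the [kappa] component of the action is differentiated. *)

Lemma cvg_mx (R : realType) (T : Type) (F : set_system T) (FF : Filter F)
    (m n : nat) (f : T -> 'M[R]_(m, n)) (l : 'M[R]_(m, n)) :
  (forall i j, f t i j @[t --> F] --> l i j) -> f @ F --> l.
Proof.
move=> fl A [P lP PA]; rewrite nbhs_filterE /=.
have H : \forall t \near F, forall i j, P i j (f t i j).
  apply: filter_forall => i; apply: filter_forall => j; exact: fl (lP i j).
by apply: filterS H => t Pt; apply: PA.
Qed.

Lemma cvg_mx_coord (R : realType) (T : Type) (F : set_system T)
    (FF : Filter F) (m n : nat) (f : T -> 'M[R]_(m, n)) (l : 'M[R]_(m, n))
    (i : 'I_m) (j : 'I_n) :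
  f @ F --> l -> f t i j @[t --> F] --> l i j.
Proof.
move=> fl.
apply: (@cvg_comp _ _ _ f (fun M : 'M[R]_(m, n) => M i j) _ _ _ fl).
exact: coord_continuous.
Qed.

Lemma cvg_sumr (R : realType) (T : Type) (F : set_system T) (FF : Filter F)
    (I : Type) (r : seq I) (f : I -> T -> R) (l : I -> R) :
  (forall i, f i @ F --> l i) ->
  \sum_(i <- r) f i t @[t --> F] --> \sum_(i <- r) l i.
Proof.
move=> fl; elim: r => [|i r IH].
  under eq_fun do rewrite big_nil.
  rewrite big_nil; exact: cvg_cst.
under eq_fun do rewrite big_cons.
by rewrite big_cons; apply: cvgD.
Qed.

Lemma cvg_prodr (R : realType) (T : Type) (F : set_system T) (FF : Filter F)
    (I : Type) (r : seq I) (f : I -> T -> R) (l : I -> R) :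
  (forall i, f i @ F --> l i) ->
  \prod_(i <- r) f i t @[t --> F] --> \prod_(i <- r) l i.
Proof.
move=> fl; elim: r => [|i r IH].
  under eq_fun do rewrite big_nil.
  rewrite big_nil; exact: cvg_cst.
under eq_fun do rewrite big_cons.
by rewrite big_cons; apply: cvgM.
Qed.

Lemma cvg_mulmx (R : realType) (T : Type) (F : set_system T) (FF : Filter F)
    (m n p : nat) (f : T -> 'M[R]_(m, n)) (g : T -> 'M[R]_(n, p))
    (a : 'M[R]_(m, n)) (b : 'M[R]_(n, p)) :
  f @ F --> a -> g @ F --> b -> f t *m g t @[t --> F] --> a *m b.
Proof.
move=> fa gb; apply: cvg_mx => i j.
under eq_fun do rewrite mxE.
rewrite mxE; apply: cvg_sumr => k.
by apply: cvgM; apply: cvg_mx_coord.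
Qed.

Lemma cvg_trmx (R : realType) (T : Type) (F : set_system T) (FF : Filter F)
    (m n : nat) (f : T -> 'M[R]_(m, n)) (a : 'M[R]_(m, n)) :
  f @ F --> a -> (f t)^T @[t --> F] --> a^T.
Proof.
move=> fa; apply: cvg_mx => i j.
by under eq_fun do rewrite mxE; rewrite mxE; apply: cvg_mx_coord.
Qed.

Lemma cvg_det (R : realType) (T : Type) (F : set_system T) (FF : Filter F)
    (n : nat) (f : T -> 'M[R]_n) (a : 'M[R]_n) :
  f @ F --> a -> \det (f t) @[t --> F] --> \det a.
Proof.
move=> fa; rewrite /determinant; apply: cvg_sumr => s.
apply: cvgM; first exact: cvg_cst.
by apply: cvg_prodr => i; apply: cvg_mx_coord.
Qed.

Lemma near_unitmx (R : realType) (T : Type) (F : set_system T)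
    (FF : Filter F) (n : nat) (f : T -> 'M[R]_n) (a : 'M[R]_n) :
  a \in unitmx -> f @ F --> a -> \forall t \near F, f t \in unitmx.
Proof.
move=> ua /cvg_det fa.
have da : \det a != 0 by rewrite -unitfE -unitmxE.
near=> t; rewrite unitmxE unitfE.
near: t; exact: cvgr_neq0 (\det a) fa da.
Unshelve. all: by end_near. Qed.

Lemma cvg_invmx (R : realType) (T : Type) (F : set_system T) (FF : Filter F)
    (n : nat) (f : T -> 'M[R]_n) (a : 'M[R]_n) :
  a \in unitmx -> f @ F --> a -> invmx (f t) @[t --> F] --> invmx a.
Proof.
move=> ua fa.
have da : \det a != 0 by rewrite -unitfE -unitmxE.
(* [invmx] is given by the cofactor formula only on invertible matrices; the limit is computed for
   the formula and carried over to [invmx], which agrees with it along the filter. *)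
suff H : (\det (f t))^-1 *: \adj (f t) @[t --> F] --> invmx a.
  apply: cvg_trans H; apply: near_eq_cvg.
  near=> t; rewrite /invmx ifT //.
  near: t; exact: near_unitmx ua fa.
rewrite /invmx ua; apply: cvgZ; first by apply: cvgV => //; apply: cvg_det.
apply: cvg_mx => i j; under eq_fun do rewrite mxE.
rewrite mxE; apply: cvgM; first exact: cvg_cst.
apply: cvg_det; apply: cvg_mx => k l; under eq_fun do rewrite !mxE.
by rewrite !mxE; apply: cvg_mx_coord.
Unshelve. all: by end_near. Qed.

Lemma cvg_dnbhs0 (R : realType) : h @[h --> (0 : R)^'] --> (0 : R).
Proof. exact: cvg_within. Qed.

Lemma cvg_line (R : realType) (F : normedModType R) (a0 a1 : F) :
  h *: a1 + a0 @[h --> (0 : R)^'] --> a0.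
Proof.
rewrite -[X in _ --> X]add0r -(scale0r a1).
apply: cvgD; last exact: cvg_cst.
by apply: cvgZ; [exact: cvg_dnbhs0|exact: cvg_cst].
Qed.

(** An exact increment [h *: q h] turns a derivative into a limit of [q]. The inverse, the change of
    coordinates and the group action are all differentiated this way. *)
Lemma is_derive_quotient (R : realType) (E F : normedModType R) (f : E -> F)
    (z w : E) (q : R -> F) (l : F) :
  (\forall h \near 0^', f (h *: w + z) = f z + h *: q h) ->
  q @ 0^' --> l -> is_derive z w f l.
Proof.
move=> fq ql.
have H : h^-1 *: (f (h *: w + z) - f z) @[h --> 0^'] --> l.
  apply: cvg_trans ql; apply: near_eq_cvg; near=> h.
  have -> : f (h *: w + z) = f z + h *: q h by near: h.
  rewrite addrC addKr scalerA mulVf ?scale1r //.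
  near: h; exact: nbhs_dnbhs_neq.
split; first by apply/cvg_ex; exists l.
exact: (cvg_lim (@norm_hausdorff _ _)).
Unshelve. all: by end_near. Qed.

(** A single directional derivative gives continuity along that line only, which is the continuity
    that differentiating an inverse requires. *)
Lemma derivable_cvg_line (R : realType) (E F : normedModType R) (f : E -> F)
    (z w : E) :
  derivable f z w -> f (h *: w + z) @[h --> 0^'] --> f z.
Proof.
move=> df; rewrite -[X in _ --> X]addr0 -[X in _ + X](scale0r ('D_w f z)).
have H : f z + h *: (h^-1 *: (f (h *: w + z) - f z)) @[h --> (0:R)^'] -->
    f z + 0 *: 'D_w f z.
  apply: cvgD; first exact: cvg_cst.
  apply: cvgZ; first exact: cvg_dnbhs0.
  exact: df.
apply: cvg_trans H; apply: near_eq_cvg; near=> h.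
rewrite scalerA mulfV ?scale1r ?subrKC //.
near: h; exact: nbhs_dnbhs_neq.
Unshelve. all: by end_near. Qed.

Lemma is_derive_quadratic (R : realType) (E F : normedModType R) (f : E -> F)
    (z w : E) (l q : F) :
  (forall h, f (h *: w + z) = f z + h *: (l + h *: q)) -> is_derive z w f l.
Proof.
move=> fq; apply: (is_derive_quotient (q := fun h => l + h *: q)).
  by near=> h.
by under eq_fun do rewrite addrC; exact: cvg_line.
Unshelve. all: by end_near. Qed.

Lemma is_derive_pair (R : realType) (E F G : normedModType R) (f : E -> F)
    (g : E -> G) (z w : E) (df : F) (dg : G) :
  is_derive z w f df -> is_derive z w g dg ->
  is_derive z w (fun x => (f x, g x) : (F * G)%type) (df, dg).
Proof.
move=> [cf <-] [cg <-].
have H : (h^-1 *: (f (h *: w + z) - f z), h^-1 *: (g (h *: w + z) - g z))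
    @[h --> (0 : R)^'] --> ('D_w f z, 'D_w g z).
  by apply: cvg_pair; [exact: cf|exact: cg].
split; first by apply/cvg_ex; exists ('D_w f z, 'D_w g z); exact: H.
exact: (cvg_lim (@norm_hausdorff _ _) H).
Qed.

Lemma is_derive_fst (R : realType) (E F G : normedModType R) (f : E -> F)
    (z w : (E * G)%type) (df : F) :
  is_derive z.1 w.1 f df -> is_derive z w (fun x => f x.1) df.
Proof. by move=> [cf df']; split. Qed.

Lemma line_derive_ext (R : realType) (E F : normedModType R) (f g : E -> F)
    (z w : E) :
  (\forall h \near 0^', f (h *: w + z) = g (h *: w + z)) -> f z = g z ->
  derivable f z w -> is_derive z w g ('D_w f z).
Proof.
move=> fg fgz df.
apply: (is_derive_quotient (q := fun h => h^-1 *: (f (h *: w + z) - f z))).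
  near=> h; rewrite scalerA mulfV ?scale1r.
    rewrite -fgz subrKC.
    by have <- : f (h *: w + z) = g (h *: w + z) by near: h.
  near: h; exact: nbhs_dnbhs_neq.
exact: df.
Unshelve. all: by end_near. Qed.

(** The increment comes from [Y_h^-1 - Y^-1 = - Y_h^-1 (Y_h - Y) Y^-1], valid once [Y_h] is
    invertible. *)
Lemma is_derive_invmx (R : realType) (E : normedModType R) (n : nat)
    (Y : E -> 'M[R]_n) (z w : E) :
  Y z \in unitmx -> derivable Y z w ->
  is_derive z w (fun x => invmx (Y x))
    (- (invmx (Y z) *m 'D_w Y z *m invmx (Y z))).
Proof.
move=> uY dY; have cY := derivable_cvg_line dY.
apply: (is_derive_quotient (q := fun h => - (invmx (Y (h *: w + z)) *m
  (h^-1 *: (Y (h *: w + z) - Y z)) *m invmx (Y z)))); last first.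
  apply: cvgN; apply: cvg_mulmx; last exact: cvg_cst.
  by apply: cvg_mulmx; [exact: cvg_invmx|exact: dY].
near=> h.
have uYh : Y (h *: w + z) \in unitmx by near: h; exact: near_unitmx uY cY.
have h0 : h != 0 by near: h; exact: nbhs_dnbhs_neq.
rewrite scalerN -scalemxAr -scalemxAl scalerA mulfV // scale1r.
rewrite mulmxBr mulmxBl mulVmx // mul1mx -mulmxA mulmxV // mulmx1.
by rewrite opprB subrKC.
Unshelve. all: by end_near. Qed.

(** * Smooth functions along a subspace *)

Definition line_open (R : realType) (E : normedModType R) (V A : set E) :=
  forall z w, A z -> V w -> \forall h \near (0 : R)^', A (h *: w + z).

Section smooth.
Variables (R : realType) (E : normedModType R) (V A : set E).
Hypothesis VA : line_open V A.

(** By [line_open], a derivative along [V] at a point of [A] sees only values on [A]. The derivative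
    of a sum, product or inverse can thus be replaced by its formula, known on [A] only, before an
    induction on [k] continues. *)
Lemma Ck_on_ext (F : normedModType R) k (f g : E -> F) :
  {in A, f =1 g} -> Ck_on V A k f -> Ck_on V A k g.
Proof.
elim: k f g => [|k IH] f g fg [cf Hf].
  by split=> //; apply: (subspace_eq_continuous fg cf).
split; first exact: (subspace_eq_continuous fg cf).
move=> w Vw; have [df Cf] := Hf w Vw.
have dg z : A z -> is_derive z w g ('D_w f z).
  move=> Az; apply: line_derive_ext (df z Az); last by apply: fg; rewrite inE.
  by apply: filterS (VA Az Vw) => h Ah; apply: fg; rewrite inE.
split=> [z Az|]; first by have [] := dg z Az.
by apply: IH Cf => z; rewrite inE => Az; have [_ ->] := dg z Az.
Qed.

Lemma Ck_on_le (F : normedModType R) k (f : E -> F) :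
  Ck_on V A k.+1 f -> Ck_on V A k f.
Proof.
elim: k f => [|k IH] f [cf Hf]; split=> // w Vw; have [df Cf] := Hf w Vw.
by split=> //; apply: IH.
Qed.

Lemma Ck_on_cst (F : normedModType R) k (a : F) : Ck_on V A k (fun=> a).
Proof.
elim: k a => [|k IH] a; split=> //; do ?exact: cst_continuous.
move=> w Vw; split=> [z _|]; first exact: derivable_cst.
have -> : (fun z => 'D_w (fun=> a) z) = fun=> 0.
  by apply/funext => z; rewrite derive_cst.
exact: IH.
Qed.

Lemma Ck_on_linear k (f : E -> R^o) :
  linear f -> continuous f -> Ck_on V A k f.
Proof.
move=> lf cf.
have D z w : is_derive z w f (f w).
  apply: (is_derive_quotient (q := fun=> f w)); last exact: cvg_cst.
  by near=> h; rewrite lf addrC.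
case: k => [|k]; split=> //; do ?exact: continuous_subspaceT.
move=> w Vw; split=> [z _|]; first by have [] := D z w.
have -> : (fun z => 'D_w f z) = fun=> f w.
  by apply/funext => z; have [_ ->] := D z w.
exact: Ck_on_cst.
Unshelve. all: by end_near. Qed.

Lemma Ck_onD k (f g : E -> R^o) :
  Ck_on V A k f -> Ck_on V A k g -> Ck_on V A k (fun z => f z + g z).
Proof.
elim: k f g => [|k IH] f g [cf Hf] [cg Hg].
  split=> //; apply/subspace_continuousP => z Az.
  by apply: cvgD;
    [move/subspace_continuousP: cf|move/subspace_continuousP: cg]; apply.
split.
  apply/subspace_continuousP => z Az.
  by apply: cvgD;
    [move/subspace_continuousP: cf|move/subspace_continuousP: cg]; apply.
move=> w Vw; have [df Cf] := Hf w Vw; have [dg Cg] := Hg w Vw.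
split=> [z Az|]; first by apply: derivableD; [exact: df|exact: dg].
apply: Ck_on_ext (IH _ _ Cf Cg) => z; rewrite inE => Az.
by rewrite (deriveD (df z Az) (dg z Az)).
Qed.

Lemma Ck_onM k (f g : E -> R^o) :
  Ck_on V A k f -> Ck_on V A k g -> Ck_on V A k (fun z => f z * g z).
Proof.
elim: k f g => [|k IH] f g Cf0 Cg0;
  have [cf Hf] := Cf0; have [cg Hg] := Cg0.
  split=> //; apply/subspace_continuousP => z Az.
  by apply: cvgM;
    [move/subspace_continuousP: cf|move/subspace_continuousP: cg]; apply.
split.
  apply/subspace_continuousP => z Az.
  by apply: cvgM;
    [move/subspace_continuousP: cf|move/subspace_continuousP: cg]; apply.
move=> w Vw; have [df Cf] := Hf w Vw; have [dg Cg] := Hg w Vw.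
split=> [z Az|]; first by apply: derivableM; [exact: df|exact: dg].
(* The product rule pairs a derivative, known to order [k], with an undifferentiated factor, known
   to order [k.+1] and lowered to [k]. *)
have H1 := IH _ _ (Ck_on_le Cf0) Cg.
have H2 := IH _ _ (Ck_on_le Cg0) Cf.
apply: Ck_on_ext (Ck_onD H1 H2) => z; rewrite inE => Az.
by rewrite (deriveM (df z Az) (dg z Az)).
Qed.

Lemma Ck_on_sum k (I : Type) (r : seq I) (f : I -> E -> R^o) :
  (forall i, Ck_on V A k (f i)) ->
  Ck_on V A k (fun z => \sum_(i <- r) f i z : R^o).
Proof.
move=> Cf; elim: r => [|i r IH].
  by under eq_fun do rewrite big_nil; exact: Ck_on_cst.
under eq_fun do rewrite big_cons.
exact: Ck_onD.
Qed.

(** Entrywise, so that matrix operations reduce to sums and products of scalar functions. *)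
Definition mx_Ck_on (m n : nat) k (M : E -> 'M[R]_(m, n)) :=
  forall i j, Ck_on V A k (fun z => M z i j : R^o).

Lemma mx_Ck_on_cst (m n : nat) k (M : 'M[R]_(m, n)) : mx_Ck_on k (fun=> M).
Proof. by move=> i j; exact: Ck_on_cst. Qed.

Lemma mx_Ck_on_linear (m n : nat) k (M : E -> 'M[R]_(m, n)) :
  linear M -> continuous M -> mx_Ck_on k M.
Proof.
move=> lM cM i j; apply: Ck_on_linear => [t u v|z]; first by rewrite lM !mxE.
by apply: cvg_mx_coord; exact: cM.
Qed.

Lemma mx_Ck_on_mul (m n p : nat) k (M : E -> 'M[R]_(m, n))
    (N : E -> 'M[R]_(n, p)) :
  mx_Ck_on k M -> mx_Ck_on k N -> mx_Ck_on k (fun z => M z *m N z).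
Proof.
move=> CM CN i j; under eq_fun do rewrite mxE.
by apply: Ck_on_sum => l; apply: Ck_onM.
Qed.

Lemma mx_Ck_onN (m n : nat) k (M : E -> 'M[R]_(m, n)) :
  mx_Ck_on k M -> mx_Ck_on k (fun z => - M z).
Proof.
move=> CM i j; under eq_fun do rewrite mxE -mulN1r.
by apply: Ck_onM => //; exact: Ck_on_cst.
Qed.

Lemma mx_Ck_onD (m n : nat) k (M N : E -> 'M[R]_(m, n)) :
  mx_Ck_on k M -> mx_Ck_on k N -> mx_Ck_on k (fun z => M z + N z).
Proof. by move=> CM CN i j; under eq_fun do rewrite mxE; exact: Ck_onD. Qed.

Lemma mx_Ck_on_tr (m n : nat) k (M : E -> 'M[R]_(m, n)) :
  mx_Ck_on k M -> mx_Ck_on k (fun z => (M z)^T).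
Proof. by move=> CM i j; under eq_fun do rewrite mxE; exact: CM. Qed.

(** The derivative [- Y^-1 Y' Y^-1] contains the inverse undifferentiated, so order [k] for the
    inverse gives order [k.+1]. The entries of [Y'] lose one order, whence the assumption on [Y] for
    every [k]. *)
Lemma mx_Ck_on_inv (n : nat) (Y : E -> 'M[R]_n) :
  (forall k, mx_Ck_on k Y) -> (forall z, A z -> Y z \in unitmx) ->
  forall k, mx_Ck_on k (fun z => invmx (Y z)).
Proof.
move=> CY uY.
have cI i j : {within A, continuous (fun z => invmx (Y z) i j : R^o)}.
  apply/subspace_continuousP => z Az; apply: cvg_mx_coord.
  apply: cvg_invmx; first exact: uY.
  apply: cvg_mx => a b; have [+ _] := CY 0 a b.
  by move/subspace_continuousP; apply.
have dY z w : A z -> V w -> derivable Y z w.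
  move=> Az Vw; apply/derivable_mxP => i j.
  by have [_ /(_ w Vw)[+ _]] := CY 1 i j; apply.
have dI z w : A z -> V w -> is_derive z w (fun z => invmx (Y z))
    (- (invmx (Y z) *m 'D_w Y z *m invmx (Y z))).
  by move=> Az Vw; apply: is_derive_invmx; [exact: uY|exact: dY].
elim=> [|k IH] i j; first by split.
split=> // w Vw.
have dIij z : A z -> derivable (fun z => invmx (Y z) i j : R^o) z w.
  move=> Az; have [d _] := dI _ _ Az Vw.
  by have /derivable_mxP := d; apply.
split=> //.
have CD : mx_Ck_on k (fun z => \matrix_(a, b) 'D_w (fun z => Y z a b : R^o) z).
  move=> a b; under eq_fun do rewrite mxE.
  by have [_ /(_ w Vw)[_ +]] := CY k.+1 a b.
have := mx_Ck_onN (mx_Ck_on_mul (mx_Ck_on_mul IH CD) IH).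
move=> /(_ i j); apply: Ck_on_ext => z; rewrite inE => Az.
have [d e] := dI _ _ Az Vw.
move: e; rewrite (derive_mx d) => /matrixP/(_ i j); rewrite mxE => ->.
by rewrite (derive_mx (dY _ _ Az Vw)).
Qed.

(** Brings smoothness from an open set and all directions down to the symmetric matrices. *)
Lemma Ck_on_sub (F : normedModType R) (V' A' : set E) k (f : E -> F) :
  V' `<=` V -> A' `<=` A -> Ck_on V A k f -> Ck_on V' A' k f.
Proof.
move=> sV sA; elim: k f => [|k IH] f [cf Hf].
  by split=> //; exact: continuous_subspaceW cf.
split; first exact: continuous_subspaceW cf.
move=> w /sV Vw; have [df Cf] := Hf w Vw.
by split=> [z /sA|]; [exact: df|exact: IH].
Qed.

End smooth.

(** * Real and imaginary parts of matrices *)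

Section complex_matrices.
Variable R : realType.
Implicit Types m n p : nat.

Definition mkC m n (x y : 'M[R]_(m, n)) : 'M[R[i]]_(m, n) :=
  cplx_mx x + 'i%C *: cplx_mx y.

Definition conj_mx m n (A : 'M[R[i]]_(m, n)) := map_mx (@conjc R) A.

Lemma mkC_coef m n (x y : 'M[R]_(m, n)) i j :
  mkC x y i j = Complex (x i j) (y i j).
Proof.
rewrite !mxE; apply/eqP; rewrite eq_complex /=.
by rewrite mul0r mulr0 subr0 addr0 mul0r add0r mul1r add0r !eqxx.
Qed.

Lemma re_mkC m n (x y : 'M[R]_(m, n)) : re_mx (mkC x y) = x.
Proof. by apply/matrixP => i j; rewrite mxE mkC_coef. Qed.

Lemma im_mkC m n (x y : 'M[R]_(m, n)) : im_mx (mkC x y) = y.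
Proof. by apply/matrixP => i j; rewrite mxE mkC_coef. Qed.

Lemma mkC_re_im m n (A : 'M[R[i]]_(m, n)) : mkC (re_mx A) (im_mx A) = A.
Proof.
by apply/matrixP => i j; rewrite mkC_coef !mxE; case: (A i j).
Qed.

Lemma mkCD m n (x y x' y' : 'M[R]_(m, n)) :
  mkC x y + mkC x' y' = mkC (x + x') (y + y').
Proof. by apply/matrixP => i j; rewrite mxE !mkC_coef !mxE. Qed.

Lemma mkCN m n (x y : 'M[R]_(m, n)) : - mkC x y = mkC (- x) (- y).
Proof. by apply/matrixP => i j; rewrite mxE !mkC_coef !mxE. Qed.

Lemma mkCZ m n (h : R) (x y : 'M[R]_(m, n)) :
  (h%:C)%C *: mkC x y = mkC (h *: x) (h *: y).
Proof.
apply/matrixP => i j; rewrite mxE !mkC_coef !mxE; apply/eqP.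
by rewrite eq_complex /= !mul0r subr0 addr0 !eqxx.
Qed.

Lemma cplx_mkC m n (x : 'M[R]_(m, n)) : cplx_mx x = mkC x 0.
Proof. by apply/matrixP => i j; rewrite mkC_coef !mxE. Qed.

Lemma cplx_mxM m n p (x : 'M[R]_(m, n)) (y : 'M[R]_(n, p)) :
  cplx_mx (x *m y) = cplx_mx x *m cplx_mx y.
Proof. exact: (map_mxM (real_complex R)). Qed.

Lemma cplx_mxD m n (x y : 'M[R]_(m, n)) :
  cplx_mx (x + y) = cplx_mx x + cplx_mx y.
Proof. exact: (map_mxD (real_complex R)). Qed.

Lemma cplx_mxN m n (x : 'M[R]_(m, n)) : cplx_mx (- x) = - cplx_mx x.
Proof. exact: (map_mxN (real_complex R)). Qed.

Lemma cplx_mx1 n : cplx_mx (1%:M : 'M[R]_n) = 1%:M.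
Proof. exact: (map_mx1 (real_complex R)). Qed.

Lemma cplx_mx_tr m n (x : 'M[R]_(m, n)) : cplx_mx x^T = (cplx_mx x)^T.
Proof. by apply/matrixP => i j; rewrite !mxE. Qed.

Lemma mkC_tr m n (x y : 'M[R]_(m, n)) : (mkC x y)^T = mkC x^T y^T.
Proof. by apply/matrixP => i j; rewrite mxE !mkC_coef !mxE. Qed.

Lemma mkCM m n p (x y : 'M[R]_(m, n)) (x' y' : 'M[R]_(n, p)) :
  mkC x y *m mkC x' y' = mkC (x *m x' - y *m y') (x *m y' + y *m x').
Proof.
rewrite /mkC mulmxDl !mulmxDr -!scalemxAl -!scalemxAr -!cplx_mxM scalerA.
have -> : 'i%C * 'i%C = -1 :> R[i] by rewrite -expr2 sqr_i.
rewrite scaleN1r !cplx_mxD cplx_mxN scalerDr.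
by rewrite [X in _ + X]addrC addrACA.
Qed.

Lemma conj_mkC m n (x y : 'M[R]_(m, n)) : conj_mx (mkC x y) = mkC x (- y).
Proof. by apply/matrixP => i j; rewrite mxE !mkC_coef !mxE. Qed.

Lemma conj_cplx_mx m n (x : 'M[R]_(m, n)) : conj_mx (cplx_mx x) = cplx_mx x.
Proof. by rewrite cplx_mkC conj_mkC oppr0. Qed.

Lemma conj_mxM m n p (A : 'M[R[i]]_(m, n)) (B : 'M[R[i]]_(n, p)) :
  conj_mx (A *m B) = conj_mx A *m conj_mx B.
Proof. exact: (map_mxM (@conjc R)). Qed.

Lemma conj_mx_tr m n (A : 'M[R[i]]_(m, n)) : conj_mx A^T = (conj_mx A)^T.
Proof. by apply/matrixP => i j; rewrite !mxE. Qed.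

Lemma conj_mx1 n : conj_mx (1%:M : 'M[R[i]]_n) = 1%:M.
Proof. by rewrite -cplx_mx1 conj_cplx_mx. Qed.

Lemma re_mxD m n (A B : 'M[R[i]]_(m, n)) : re_mx (A + B) = re_mx A + re_mx B.
Proof. by rewrite -(mkC_re_im A) -(mkC_re_im B) mkCD !re_mkC. Qed.

Lemma im_mxD m n (A B : 'M[R[i]]_(m, n)) : im_mx (A + B) = im_mx A + im_mx B.
Proof. by rewrite -(mkC_re_im A) -(mkC_re_im B) mkCD !im_mkC. Qed.

Lemma re_mxZ m n (h : R) (A : 'M[R[i]]_(m, n)) :
  re_mx ((h%:C)%C *: A) = h *: re_mx A.
Proof. by rewrite -(mkC_re_im A) mkCZ !re_mkC. Qed.

Lemma im_mxZ m n (h : R) (A : 'M[R[i]]_(m, n)) :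
  im_mx ((h%:C)%C *: A) = h *: im_mx A.
Proof. by rewrite -(mkC_re_im A) mkCZ !im_mkC. Qed.

Lemma re_mxM m n p (A : 'M[R[i]]_(m, n)) (B : 'M[R[i]]_(n, p)) :
  re_mx (A *m B) = re_mx A *m re_mx B - im_mx A *m im_mx B.
Proof.
by rewrite -{1}(mkC_re_im A) -{1}(mkC_re_im B) mkCM re_mkC.
Qed.

Lemma im_mxM m n p (A : 'M[R[i]]_(m, n)) (B : 'M[R[i]]_(n, p)) :
  im_mx (A *m B) = re_mx A *m im_mx B + im_mx A *m re_mx B.
Proof.
by rewrite -{1}(mkC_re_im A) -{1}(mkC_re_im B) mkCM im_mkC.
Qed.

Lemma re_mxtr m n (A : 'M[R[i]]_(m, n)) : re_mx A^T = (re_mx A)^T.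
Proof. by apply/matrixP => i j; rewrite !mxE. Qed.

Lemma im_mxtr m n (A : 'M[R[i]]_(m, n)) : im_mx A^T = (im_mx A)^T.
Proof. by apply/matrixP => i j; rewrite !mxE. Qed.

Lemma Re_mxtrace n (A : 'M[R[i]]_n) : complex.Re (\tr A) = \tr (re_mx A).
Proof.
rewrite /mxtrace; under [RHS]eq_bigr do rewrite mxE.
by apply: (big_morph (@complex.Re R)) => // -[a b] [a' b'].
Qed.

End complex_matrices.

(** * Positive definite matrices *)

Section posdef.
Variable R : realType.
Implicit Types n : nat.

Lemma posdef_ge0 n (y : 'M[R]_n) (r : 'rV[R]_n) :
  posdef y -> 0 <= (r *m y *m r^T) 0 0.
Proof.
move=> py; have [->|r0] := eqVneq r 0; last exact/ltW/py.
by rewrite !mul0mx mxE.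
Qed.

Lemma posdef_unit n (y : 'M[R]_n) : posdef y -> y \in unitmx.
Proof.
move=> py; rewrite -row_free_unit -kermx_eq0; apply/eqP/row_matrixP => i.
rewrite row0; apply/eqP; apply: contraT => /py.
by rewrite -row_mul mulmx_ker row0 mul0mx mxE ltxx.
Qed.

Lemma invmx_sym n (y : 'M[R]_n) : y^T = y -> (invmx y)^T = invmx y.
Proof. by move=> sy; rewrite trmx_inv sy. Qed.

Lemma posdef_inv n (y : 'M[R]_n) :
  y^T = y -> posdef y -> posdef (invmx y).
Proof.
move=> sy py r r0; have uy := posdef_unit py.
have := py (r *m invmx y); rewrite mulmxKV // trmx_mul (invmx_sym sy) !mulmxA.
apply; apply: contraNneq r0 => e.
by rewrite -[r](mulmxKV uy) e mul0mx.
Qed.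

(** Induction on the Schur complement [s] of the corner entry [b]: if [s = L' L'^T], the factor is
    lower triangular with first column [sqrt b], [r^T / sqrt b] and remaining block [L']. *)
Lemma cholesky n (y : 'M[R]_n) :
  y^T = y -> posdef y -> exists L : 'M[R]_n, y = L *m L^T.
Proof.
elim: n y => [|n IH] y sy py; first by exists 0; apply/matrixP => -[].
change 'M[R]_(1 + n) in y.
set b := y 0 0; set r := ursubmx y; set y' := drsubmx y.
have ulE : ulsubmx y = b%:M.
  apply/matrixP => i j; rewrite !ord1 !mxE mulr1n.
  by congr (y _ _); apply: val_inj.
have dlE : dlsubmx y = r^T by rewrite /r trmx_ursub sy.
have yE : y = block_mx b%:M r r^T y' by rewrite -ulE -dlE submxK.
have sy' : y'^T = y' by rewrite /y' trmx_drsub sy.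
have b0 : 0 < b.
  have e0 : delta_mx 0 0 != 0 :> 'rV[R]_(1 + n).
    by apply/eqP => /matrixP/(_ 0 0)/eqP; rewrite !mxE !eqxx oner_eq0.
  by have := py _ e0; rewrite trmx_delta -rowE -colE !mxE.
pose s := y' - b^-1 *: (r^T *m r).
have ss : s^T = s.
  by rewrite /s linearB /= linearZ /= trmx_mul trmxK sy'.
have ps : posdef s.
  (* This [k] solves [k b + t r^T = 0], so that the form of [y] at [(k, t)] is the form of [s] at
     [t]. *)
  move=> t t0; pose k := - b^-1 *: (t *m r^T).
  have : row_mx k t != 0 ->
      0 < (row_mx k t *m block_mx b%:M r r^T y' *m (row_mx k t)^T) 0 0.
    by rewrite -yE; exact: py.
  rewrite tr_row_mx mul_row_block mul_row_col.
  have kE : k *m b%:M + t *m r^T = 0.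
    rewrite mul_mx_scalar /k scalerA mulrN mulfV ?gt_eqF //.
    by rewrite scaleN1r addNr.
  rewrite kE mul0mx add0r.
  have -> : k *m r + t *m y' = t *m s.
    by rewrite /s mulmxBr addrC -scalemxAr mulmxA /k -scalemxAl scaleNr.
  apply; apply: contra t0 => /eqP/(congr1 rsubmx).
  by rewrite row_mxKr linear0 => ->.
have [L' L'E] := IH _ ss ps.
pose q := Num.sqrt b.
have q2 : q * q = b by rewrite -expr2 sqr_sqrtr ?ltW.
have q0 : q != 0 by rewrite sqrtr_eq0 -ltNge.
pose L : 'M[R]_(1 + n) := block_mx q%:M 0 (q^-1 *: r^T) L'.
suff E : y = L *m L^T by exists L.
rewrite yE /L tr_block_mx mulmx_block !trmx0 !mulmx0 !mul0mx !addr0.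
rewrite tr_scalar_mx -scalar_mxM q2; congr block_mx.
- by rewrite mul_scalar_mx linearZ /= trmxK scalerA mulfV // scale1r.
- by rewrite mul_mx_scalar scalerA mulfV // scale1r.
- rewrite linearZ /= trmxK -scalemxAl -scalemxAr scalerA -invfM q2 -L'E /s.
  by rewrite subrKC.
Qed.

Lemma mxtrace_sqr_ge0 m n (A : 'M[R]_(m, n)) : 0 <= \tr (A *m A^T).
Proof.
apply: sumr_ge0 => i _; rewrite mxE; apply: sumr_ge0 => j _.
by rewrite mxE -expr2 sqr_ge0.
Qed.

Lemma mxtrace_sqr_eq0 m n (A : 'M[R]_(m, n)) : \tr (A *m A^T) = 0 -> A = 0.
Proof.
move=> t0; apply/matrixP => i j; rewrite mxE.
have s0 k l : 0 <= A k l * A^T l k by rewrite mxE -expr2 sqr_ge0.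
have d0 k : 0 <= (A *m A^T) k k by rewrite mxE sumr_ge0.
have := psumr_eq0P (fun k _ => d0 k) t0 (i := i) isT; rewrite mxE => H.
have := psumr_eq0P (fun l _ => s0 i l) H (i := j) isT.
by rewrite mxE => /eqP; rewrite mulf_eq0 orbb => /eqP.
Qed.

(** Moving one factor [L] around the trace exhibits [tr (B A B A)], for [B = L L^T], as the squared
    Frobenius norm of [L^T A L]. *)
Lemma mxtrace_congr n (L A : 'M[R]_n) : A^T = A ->
  \tr (L *m L^T *m A *m (L *m L^T *m A)) =
  \tr (L^T *m A *m L *m (L^T *m A *m L)^T).
Proof.
move=> sA; rewrite -!mulmxA mxtrace_mulC !trmx_mul trmxK sA.
by rewrite !mulmxA.
Qed.

Lemma mxtrace_posdef_ge0 n (B A : 'M[R]_n) :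
  B^T = B -> posdef B -> A^T = A -> 0 <= \tr (B *m A *m (B *m A)).
Proof.
move=> sB pB sA; have [L ->] := cholesky sB pB.
by rewrite mxtrace_congr // mxtrace_sqr_ge0.
Qed.

(** The norm vanishes, so [L^T A L = 0]; multiplying by [L] and [L^T] gives [B A B = 0], and the
    invertible [B] cancels on both sides. *)
Lemma mxtrace_posdef_eq0 n (B A : 'M[R]_n) :
  B^T = B -> posdef B -> A^T = A ->
  \tr (B *m A *m (B *m A)) = 0 -> A = 0.
Proof.
move=> sB pB sA; have uB := posdef_unit pB; have [L BE] := cholesky sB pB.
rewrite {1 2}BE mxtrace_congr // => /mxtrace_sqr_eq0 L0.
have BAB : B *m (A *m B) = 0.
  have -> : B *m (A *m B) = L *m (L^T *m A *m L) *m L^T by rewrite BE !mulmxA.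
  by rewrite L0 mulmx0 mul0mx.
by rewrite -[A](mulmxK uB) -[A *m B](mulKmx uB) BAB mulmx0 mul0mx.
Qed.

End posdef.

(** * The symplectic action *)

Section symplectic.
Variables (R : realType) (n : nat) (M : 'M[R]_(n + n)).
Hypothesis SpM : Sp M.

Local Notation a := (ulsubmx M).
Local Notation b := (ursubmx M).
Local Notation c := (dlsubmx M).
Local Notation d := (drsubmx M).

(** [M^T J M = J] makes [- J M^T J] a left inverse of [M], hence a right inverse; multiplying
    [M J M^T J = -1] by [J] gives the claim. *)
Lemma Sp_trmx : Sp M^T.
Proof.
have JJ : J_mx R n *m J_mx R n = - 1%:M.
  rewrite /J_mx mulmx_block !mul0mx !mulmx0 !mul1mx !mulmx1 !addr0 !add0r.
  by rewrite scalar_mx_block opp_block_mx !oppr0.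
have inv : (- (J_mx R n *m M^T *m J_mx R n)) *m M = 1%:M.
  rewrite mulNmx -!mulmxA (mulmxA M^T) (_ : M^T *m _ *m M = J_mx R n) //.
  by rewrite JJ opprK.
have := mulmx1C inv; rewrite mulmxN => /(congr1 (fun X => - X *m J_mx R n)).
rewrite /Sp /= trmxK opprK mulNmx mul1mx -!mulmxA JJ !mulmxN !mulmx1.
by move/eqP; rewrite eqr_opp => /eqP; rewrite !mulmxA.
Qed.

Lemma Sp_blocks :
  [/\ a^T *m c = c^T *m a, b^T *m d = d^T *m b & a^T *m d - c^T *m b = 1%:M].
Proof.
have := SpM; rewrite /Sp /= -[M]submxK tr_block_mx /J_mx !mulmx_block.
rewrite !submxK !mulmx0 !mulmx1 !mulmxN !mulmx1 !add0r !addr0 !mulNmx.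
case/eq_block_mx => h1 h2 _ h4; split.
- by apply/eqP; rewrite -subr_eq0 addrC h1.
- by apply/eqP; rewrite -subr_eq0 addrC h4.
- by rewrite addrC h2.
Qed.

End symplectic.

(** Relations between rows of blocks. They govern the denominator and the imaginary part of the
    image; the column relations of [Sp_blocks] govern its symmetry, the cocycle and the action on
    [(p, q)]. *)
Lemma Sp_blocks_tr (R : realType) (n : nat) (M : 'M[R]_(n + n)) : Sp M ->
  [/\ ulsubmx M *m (ursubmx M)^T = ursubmx M *m (ulsubmx M)^T,
      dlsubmx M *m (drsubmx M)^T = drsubmx M *m (dlsubmx M)^T
    & ulsubmx M *m (drsubmx M)^T - ursubmx M *m (dlsubmx M)^T = 1%:M].
Proof.
move=> /Sp_trmx/Sp_blocks.
by rewrite -trmx_ulsub -trmx_ursub -trmx_dlsub -trmx_drsub !trmxK.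
Qed.

Section action.
Variables (R : realType) (n : nat) (M : 'M[R]_(n + n)).
Hypothesis SpM : Sp M.

Local Notation a := (ulsubmx M).
Local Notation b := (ursubmx M).
Local Notation c := (dlsubmx M).
Local Notation d := (drsubmx M).

Definition act_num (v : 'M[R[i]]_n) := cplx_mx a *m v + cplx_mx b.
Definition act_den (v : 'M[R[i]]_n) := cplx_mx c *m v + cplx_mx d.

(* The inverse of the imaginary part of the image of [x + i y];
   equal to [W y^-1 W^*] for [W = act_den (x + i y)]. *)
Definition act_gram (x y : 'M[R]_n) :=
  (c *m x + d) *m invmx y *m (c *m x + d)^T + c *m y *m c^T.

(** This is [y^-1 W^* S^-1] with [W^* = (c x + d)^T - i y c^T]; in the imaginary part [y^-1 y] has
    been cancelled. Only the real matrices [y] and [S] are inverted. *)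
Definition act_den_inv (x y : 'M[R]_n) : 'M[R[i]]_n :=
  mkC (invmx y *m (c *m x + d)^T *m invmx (act_gram x y))
      (- (c^T *m invmx (act_gram x y))).

Lemma act_den_mkC x y : act_den (mkC x y) = mkC (c *m x + d) (c *m y).
Proof.
by rewrite /act_den !cplx_mkC mkCM mkCD !mul0mx subr0 !addr0.
Qed.

Lemma act_num_mkC x y : act_num (mkC x y) = mkC (a *m x + b) (a *m y).
Proof.
by rewrite /act_num !cplx_mkC mkCM mkCD !mul0mx subr0 !addr0.
Qed.

Lemma act_gram_sym x y : x^T = x -> y^T = y -> (act_gram x y)^T = act_gram x y.
Proof.
move=> sx sy; rewrite /act_gram linearD /= !trmx_mul !trmxK sy.
by rewrite (invmx_sym sy) !mulmxA.
Qed.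

(** The real part of the product is [S S^-1]. The imaginary part vanishes because [(c x + d) c^T] is
    symmetric, by [c d^T = d c^T]. *)
Lemma act_denK x y : x^T = x -> y^T = y -> y \in unitmx ->
  act_gram x y \in unitmx ->
  act_den (mkC x y) *m act_den_inv x y = 1%:M.
Proof.
move=> sx sy uy uS; rewrite act_den_mkC /act_den_inv.
rewrite mkCM -cplx_mx1 cplx_mkC; congr mkC.
  rewrite mulmxN opprK !mulmxA -mulmxDl.
  exact: mulmxV.
rewrite mulmxN !mulmxA mulmxK // -mulNmx -mulmxDl.
rewrite -[RHS](mul0mx _ (invmx (act_gram x y))).
congr (_ *m _); have [_ cd _] := Sp_blocks_tr SpM.
by rewrite linearD /= trmx_mul sx mulmxDr mulmxDl cd !mulmxA addNr.
Qed.

Lemma invmx_act_den x y : x^T = x -> y^T = y -> y \in unitmx ->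
  act_gram x y \in unitmx ->
  invmx (act_den (mkC x y)) = act_den_inv x y.
Proof.
move=> sx sy uy uS; have K := act_denK sx sy uy uS.
have [uW _] := mulmx1_unit K.
by rewrite -[LHS]mulmx1 -K mulKmx.
Qed.

(** [r S r^T] is the squared [y^-1]-norm of [r (c x + d)] plus the squared [y]-norm of [r c]. If
    both vanish then [r c = r d = 0], and [d a^T - c b^T = 1] forces [r = 0]. *)
Lemma act_gram_posdef x y : x^T = x -> y^T = y -> posdef y ->
  posdef (act_gram x y).
Proof.
move=> sx sy py r r0.
have E : r *m act_gram x y *m r^T =
    (r *m (c *m x + d)) *m invmx y *m (r *m (c *m x + d))^T
    + (r *m c) *m y *m (r *m c)^T.
  by rewrite /act_gram mulmxDr mulmxDl !trmx_mul !mulmxA.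
have piy := posdef_inv sy py.
rewrite E mxE.
have [rc0|rc0] := eqVneq (r *m c) 0.
  rewrite rc0 !mul0mx [X in _ + X]mxE addr0; apply: piy.
  rewrite mulmxDr mulmxA rc0 mul0mx add0r.
  apply: contraNneq r0 => rd0.
  have [_ _ /(congr1 trmx)] := Sp_blocks_tr SpM.
  rewrite linearB /= !trmx_mul !trmxK trmx1 => e.
  by rewrite -[r]mulmx1 -e mulmxBr !mulmxA rc0 rd0 !mul0mx subrr.
by apply: ltr_wpDl; [exact: posdef_ge0|exact: py].
Qed.

Section point.
Variables (x y : 'M[R]_n).
Hypotheses (sx : x^T = x) (sy : y^T = y) (py : posdef y).

Local Notation v := (mkC x y).
Local Notation D := (invmx (act_den v)).
Local Notation v1 := (act_num v *m D).

Let uy : y \in unitmx := posdef_unit py.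
Let uS : act_gram x y \in unitmx := posdef_unit (act_gram_posdef sx sy py).

Lemma act_den_unit : act_den v \in unitmx.
Proof. by have [] := mulmx1_unit (act_denK sx sy uy uS). Qed.

(** The numerator in front of [S^-1] is [a (c x + d)^T - (a x + b) c^T]; the terms in [x] cancel and
    [a d^T - b c^T = 1] remains. *)
Lemma im_act : im_mx v1 = invmx (act_gram x y).
Proof.
rewrite invmx_act_den // act_num_mkC /act_den_inv mkCM im_mkC.
rewrite mulmxN !mulmxA mulmxK // -mulNmx -mulmxDl -[RHS]mul1mx.
congr (_ *m _); have [_ _ <-] := Sp_blocks_tr SpM.
rewrite linearD /= trmx_mul sx mulmxDr mulmxDl !mulmxA.
by rewrite opprD addrC addrACA subrr add0r.
Qed.

Let vT : v^T = v. Proof. by rewrite mkC_tr sx sy. Qed.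

Let Cac : (cplx_mx a)^T *m cplx_mx c = (cplx_mx c)^T *m cplx_mx a.
Proof. by rewrite -!cplx_mx_tr -!cplx_mxM; have [-> _ _] := Sp_blocks SpM. Qed.

Let Cbd : (cplx_mx b)^T *m cplx_mx d = (cplx_mx d)^T *m cplx_mx b.
Proof. by rewrite -!cplx_mx_tr -!cplx_mxM; have [_ -> _] := Sp_blocks SpM. Qed.

Let Cad : (cplx_mx a)^T *m cplx_mx d = 1%:M + (cplx_mx c)^T *m cplx_mx b.
Proof.
rewrite -!cplx_mx_tr -!cplx_mxM -cplx_mx1; have [_ _ <-] := Sp_blocks SpM.
by rewrite -cplx_mxD subrK.
Qed.

Let Cda : (cplx_mx d)^T *m cplx_mx a = 1%:M + (cplx_mx b)^T *m cplx_mx c.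
Proof.
have /(congr1 trmx) := Cad; rewrite linearD /= !trmx_mul !trmxK trmx1.
by [].
Qed.

Let denT : (act_den v)^T = v *m (cplx_mx c)^T + (cplx_mx d)^T.
Proof. by rewrite /act_den linearD /= trmx_mul vT. Qed.

Let numT : (act_num v)^T = v *m (cplx_mx a)^T + (cplx_mx b)^T.
Proof. by rewrite /act_num linearD /= trmx_mul vT. Qed.

(** For [v1 = N W^-1], symmetry amounts to [W^T N = N^T W], and the column relations identify the
    two expansions. *)
Lemma act_sym : v1^T = v1.
Proof.
have uW := act_den_unit.
have E : (act_den v)^T *m act_num v = (act_num v)^T *m act_den v.
  rewrite denT numT /act_den /act_num.
  have expand (X Y Z T : 'M[R[i]]_n) : (v *m X^T + Y^T) *m (Z *m v + T) =
      v *m (X^T *m Z) *m v + v *m (X^T *m T) + (Y^T *m Z *m v + Y^T *m T).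
    by rewrite mulmxDl !mulmxDr !mulmxA.
  rewrite !expand Cac Cda Cad Cbd mulmxDl mulmxDr mul1mx mulmx1.
  have AC (X P u Q Z : 'M[R[i]]_n) :
      X + P + (u + Q + Z) = X + (u + P + (Q + Z)).
    by rewrite -!addrA; congr (_ + _); exact: addrCA.
  by rewrite AC !addrA.
have DW : act_den v *m D = 1%:M by rewrite mulmxV.
have DWT : D^T *m (act_den v)^T = 1%:M by rewrite -trmx_mul DW trmx1.
rewrite trmx_mul -[LHS]mulmx1 -DW mulmxA -(mulmxA D^T) -E mulmxA DWT mul1mx.
by [].
Qed.

(** The left factor of [dv] in the differential of the action. Writing [v1 = D^T N^T] by symmetry,
    it remains to see that [W^T a - N^T c = 1]: the terms in [v] cancel and [d^T a - b^T c] is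
    left. *)
Lemma act_cocycle : cplx_mx a - v1 *m cplx_mx c = D^T.
Proof.
have uW := act_den_unit.
have DWT : D^T *m (act_den v)^T = 1%:M by rewrite -trmx_mul mulmxV ?trmx1.
rewrite -act_sym trmx_mul -[cplx_mx a]mul1mx -DWT -!mulmxA -mulmxBr.
rewrite -[RHS]mulmx1; congr (_ *m _).
rewrite denT numT !mulmxDl Cda -!mulmxA Cac.
by rewrite opprD addrACA subrr add0r addrK.
Qed.

(** The Hermitian factorisation through which the real [S] cancels [D] in the invariant forms. *)
Lemma act_gram_complex :
  cplx_mx (act_gram x y) =
  act_den v *m cplx_mx (invmx y) *m (conj_mx (act_den v))^T.
Proof.
rewrite act_den_mkC conj_mkC cplx_mkC mkC_tr (cplx_mkC (invmx y)) !mkCM.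
rewrite !mulmx0 subr0 add0r mulmxK // linearN /= mulmxN opprK.
rewrite trmx_mul sy /act_gram mulmxA; congr mkC.
rewrite mulmxN mulmxA mulmxKV //.
have [_ cd _] := Sp_blocks_tr SpM.
by rewrite linearD /= trmx_mul sx mulmxDr mulmxDl cd !mulmxA addNr.
Qed.

End point.
End action.

(** * The two invariant forms and their congruences *)

Section forms.
Variables (R : realType) (n : nat).
Implicit Types (B : 'M[R]_n) (V : 'M[R[i]]_n) (u : 'rV[R[i]]_n).

Definition siegel_form B V V' : R :=
  \tr (B *m re_mx V *m (B *m re_mx V') + B *m im_mx V *m (B *m im_mx V')).

Definition fiber_form B u u' : R :=
  (re_mx u *m B *m (re_mx u')^T + im_mx u *m B *m (im_mx u')^T) 0 0.

Lemma re_cplx_mx m p (X : 'M[R]_(m, p)) : re_mx (cplx_mx X) = X.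
Proof. by rewrite cplx_mkC re_mkC. Qed.

Lemma im_cplx_mx m p (X : 'M[R]_(m, p)) : im_mx (cplx_mx X) = 0.
Proof. by rewrite cplx_mkC im_mkC. Qed.

Lemma re_conj_mx m p (X : 'M[R[i]]_(m, p)) : re_mx (conj_mx X) = re_mx X.
Proof. by rewrite -(mkC_re_im X) conj_mkC !re_mkC. Qed.

Lemma im_conj_mx m p (X : 'M[R[i]]_(m, p)) : im_mx (conj_mx X) = - im_mx X.
Proof. by rewrite -(mkC_re_im X) conj_mkC !im_mkC. Qed.

Lemma conj_mxK m p (X : 'M[R[i]]_(m, p)) : conj_mx (conj_mx X) = X.
Proof. by rewrite -(mkC_re_im X) !conj_mkC opprK. Qed.

(** Since [B] is real, the mixed products of real and imaginary parts contribute only to the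
    imaginary part of the trace. The Hermitian form makes congruence by a complex matrix
    possible. *)
Lemma siegel_formE B V V' :
  siegel_form B V V' =
  complex.Re (\tr (cplx_mx B *m V *m (cplx_mx B *m conj_mx V'))).
Proof.
rewrite Re_mxtrace /siegel_form !(re_mxM, im_mxM) re_cplx_mx im_cplx_mx.
by rewrite re_conj_mx im_conj_mx !mul0mx !subr0 !addr0 !mulmxN opprK.
Qed.

Lemma fiber_formE B u u' :
  fiber_form B u u' =
  re_mx (u *m cplx_mx B *m (conj_mx u')^T) 0 0.
Proof.
rewrite /fiber_form !(re_mxM, im_mxM) re_cplx_mx im_cplx_mx re_mxtr im_mxtr.
by rewrite re_conj_mx im_conj_mx !mulmx0 subr0 add0r linearN /= mulmxN opprK.
Qed.

Section congruence.
Variables (B S : 'M[R]_n) (W D : 'M[R[i]]_n).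
Hypotheses (DW : D *m W = 1%:M)
  (SE : cplx_mx S = W *m cplx_mx B *m (conj_mx W)^T).

Let SEc : cplx_mx S = conj_mx W *m cplx_mx B *m W^T.
Proof.
have /(congr1 (@conj_mx R _ _)) := SE.
by rewrite !conj_mxM !conj_cplx_mx conj_mx_tr conj_mxK.
Qed.

Let DWT : W^T *m D^T = 1%:M. Proof. by rewrite -trmx_mul DW trmx1. Qed.

Let cDW : conj_mx D *m conj_mx W = 1%:M.
Proof. by rewrite -conj_mxM DW conj_mx1. Qed.

Let cDWT : (conj_mx W)^T *m (conj_mx D)^T = 1%:M.
Proof. by rewrite -trmx_mul cDW trmx1. Qed.

(** [S] is real, hence equal to its conjugate: the first occurrence is written [conj W B W^T] and
    the second [W B W^*]. Each adjacent [D] then cancels, and cyclicity of the trace removes the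
    outer pair. *)
Lemma siegel_form_congr V V' :
  siegel_form S (D^T *m V *m D) (D^T *m V' *m D) = siegel_form B V V'.
Proof.
rewrite !siegel_formE; congr complex.Re.
rewrite {1}SEc SE !conj_mxM conj_mx_tr.
rewrite -!mulmxA (mulmxA W^T) DWT mul1mx (mulmxA D) DW mul1mx.
rewrite (mulmxA (conj_mx W)^T) cDWT mul1mx mxtrace_mulC -!mulmxA cDW mulmx1.
by [].
Qed.

Lemma fiber_form_congr u u' :
  fiber_form S (u *m D) (u' *m D) = fiber_form B u u'.
Proof.
rewrite !fiber_formE; congr (re_mx _ 0 0).
rewrite SE conj_mxM trmx_mul -!mulmxA (mulmxA D) DW mul1mx.
by rewrite (mulmxA (conj_mx W)^T) cDWT mul1mx.
Qed.

End congruence.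
End forms.

(** * The real coordinates p and q, and the symplectic action on them *)

Section pq.
Variables (R : realType) (n : nat).
Implicit Types (x y : 'M[R]_n) (p q : 'rV[R]_n) (v : 'M[R[i]]_n).

Lemma p_of_pq v p q : im_mx v \in unitmx ->
  p_of (v, cplx_mx p *m v + cplx_mx q) = p.
Proof.
move=> uv; rewrite /p_of /= im_mxD im_mxM re_cplx_mx !im_cplx_mx.
by rewrite mul0mx !addr0 mulmxK.
Qed.

Lemma q_of_pq v p q : im_mx v \in unitmx ->
  q_of (v, cplx_mx p *m v + cplx_mx q) = q.
Proof.
move=> uv; rewrite /q_of p_of_pq //= re_mxD re_mxM !re_cplx_mx !im_cplx_mx.
by rewrite mul0mx subr0 addrC addKr.
Qed.

Lemma pq_ofK v u : im_mx v \in unitmx ->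
  cplx_mx (p_of (v, u)) *m v + cplx_mx (q_of (v, u)) = u.
Proof.
move=> uv; rewrite -[RHS]mkC_re_im -[v in _ *m v]mkC_re_im !cplx_mkC mkCM mkCD.
by rewrite !mul0mx subr0 !addr0 /q_of subrKC /p_of /= mulmxKV.
Qed.

End pq.

Section action_pq.
Variables (R : realType) (n : nat) (M : 'M[R]_(n + n)).
Hypothesis SpM : Sp M.

Local Notation a := (ulsubmx M).
Local Notation b := (ursubmx M).
Local Notation c := (dlsubmx M).
Local Notation d := (drsubmx M).

(* [(act_p p q, act_q p q)] is [(p, q) M^-1]. *)
Definition act_p (p q : 'rV[R]_n) := p *m d^T - q *m c^T.
Definition act_q (p q : 'rV[R]_n) := q *m a^T - p *m b^T.

Lemma act_pq_num p q : act_p p q *m a + act_q p q *m c = p.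
Proof.
have [ac _ ad] := Sp_blocks SpM.
have da : d^T *m a - b^T *m c = 1%:M.
  by have /(congr1 trmx) := ad; rewrite linearB /= !trmx_mul !trmxK trmx1.
rewrite /act_p /act_q !mulmxBl -!mulmxA ac addrA subrK.
by rewrite -mulmxBr da mulmx1.
Qed.

Lemma act_pq_den p q : act_p p q *m b + act_q p q *m d = q.
Proof.
have [_ bd ad] := Sp_blocks SpM.
rewrite /act_p /act_q !mulmxBl -!mulmxA bd addrC addrA subrK.
by rewrite -mulmxBr ad mulmx1.
Qed.

(** Numerator and denominator, stacked, are [M] applied to [v] stacked over [1]; [(p, q) M^-1] on
    the left undoes [M]. *)
Lemma act_pq_complex v p q :
  cplx_mx (act_p p q) *m act_num M v + cplx_mx (act_q p q) *m act_den M v =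
  cplx_mx p *m v + cplx_mx q.
Proof.
rewrite /act_num /act_den !mulmxDr addrACA !mulmxA -mulmxDl -!cplx_mxM.
by rewrite -!cplx_mxD act_pq_num act_pq_den.
Qed.

(** [M^-1] preserves the symplectic pairing. Expanding only the second pair moves the blocks of [M]
    onto the first, where [M^-1 M] cancels. *)
Lemma act_pq_symplectic p q p' q' :
  act_p p q *m (act_q p' q')^T - act_q p q *m (act_p p' q')^T =
  p *m q'^T - q *m p'^T.
Proof.
have -> : (act_q p' q')^T = a *m q'^T - b *m p'^T.
  by rewrite /act_q linearB /= !trmx_mul !trmxK.
have -> : (act_p p' q')^T = d *m p'^T - c *m q'^T.
  by rewrite /act_p linearB /= !trmx_mul !trmxK.
transitivity ((act_p p q *m a + act_q p q *m c) *m q'^T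
  - (act_p p q *m b + act_q p q *m d) *m p'^T); last first.
  by rewrite act_pq_num act_pq_den.
move: (act_p p q) (act_q p q) => P Q.
rewrite !mulmxBr !mulmxDl !mulmxA opprB opprD.
exact: addrACA.
Qed.

End action_pq.

(** * The invariant metrics *)

Section metric.
Variables (R : realType) (n : nat).
Local Notation E := (row_coords R n).

Definition vC (z : E) : 'M[R[i]]_n := mkC z.1.1.1 z.1.1.2.
Definition uC (z : E) : 'rV[R[i]]_n := mkC z.1.2 z.2.

Lemma param_xirhoE (z : E) : param_xirho z = (vC z, uC z).
Proof. by case: z => [[[x y] xi] rho]. Qed.

Lemma coords_xirhoK (z : sj_pt R n) :
  (vC (coords_xirho z), uC (coords_xirho z)) = z.
Proof. by case: z => v u; rewrite /vC /uC /= !mkC_re_im. Qed.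

Lemma dom_xirhoE (z : E) : dom_xirho z <->
  [/\ z.1.1.1^T = z.1.1.1, z.1.1.2^T = z.1.1.2 & posdef z.1.1.2].
Proof.
rewrite /dom_xirho /preimage /= param_xirhoE /siegel_jacobi /siegel /=.
by rewrite re_mkC im_mkC.
Qed.

Lemma row_tangentE (w : E) : row_tangent w <->
  w.1.1.1^T = w.1.1.1 /\ w.1.1.2^T = w.1.1.2.
Proof. by case: w => [[[x y] xi] rho]. Qed.

(* [du - p dv], with real and imaginary parts written out. *)
Definition eta (z w : E) : 'rV[R[i]]_n :=
  mkC (w.1.2 - z.2 *m invmx z.1.1.2 *m w.1.1.1)
      (w.2 - z.2 *m invmx z.1.1.2 *m w.1.1.2).

Definition sj_metric (alpha gamma : R) (z w w' : E) : R :=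
  alpha * siegel_form (invmx z.1.1.2) (vC w) (vC w')
  + gamma * fiber_form (invmx z.1.1.2) (eta z w) (eta z w').

Lemma etaE (z w : E) : eta z w = uC w - cplx_mx (p_of (vC z, uC z)) *m vC w.
Proof.
rewrite /eta /p_of /uC /vC /= !im_mkC cplx_mkC mkCM mkCN mkCD.
by rewrite !mul0mx subr0 addr0.
Qed.

Definition sj_p (z : E) : 'rV[R]_n := p_of (vC z, uC z).
Definition sj_q (z : E) : 'rV[R]_n := q_of (vC z, uC z).
(* The differentials of [sj_p] and [sj_q], read off from [eta = dp v + dq]. *)
Definition sj_dp (z w : E) : 'rV[R]_n := p_of (vC z, eta z w).
Definition sj_dq (z w : E) : 'rV[R]_n := q_of (vC z, eta z w).

(** The form [d kappa - p dq^t + q dp^t] carried to the model [(xi, rho)], where [p], [q] and their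
    differentials are functions of the point and of the tangent vector. *)
Definition sj_contact (z w : ext_coords R n) : R :=
  w.2 - (sj_p z.1 *m (sj_dq z.1 w.1)^T) 0 0
      + (sj_q z.1 *m (sj_dp z.1 w.1)^T) 0 0.

Definition sj_ext_metric (alpha gamma delta : R)
    (z w w' : ext_coords R n) : R :=
  sj_metric alpha gamma z.1 w.1 w'.1
  + delta * (sj_contact z w * sj_contact z w').

Lemma sj_pE z : sj_p z = z.2 *m invmx z.1.1.2.
Proof. by rewrite /sj_p /p_of /= !im_mkC. Qed.

Lemma sj_qE z : sj_q z = z.1.2 - sj_p z *m z.1.1.1.
Proof. by rewrite /sj_q /q_of /= !re_mkC. Qed.

Lemma sj_dpE z w : sj_dp z w = (w.2 - sj_p z *m w.1.1.2) *m invmx z.1.1.2.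
Proof. by rewrite /sj_dp /p_of /= !im_mkC sj_pE. Qed.

Lemma sj_dqE z w :
  sj_dq z w = w.1.2 - sj_p z *m w.1.1.1 - sj_dp z w *m z.1.1.1.
Proof. by rewrite /sj_dq /q_of /= !re_mkC sj_pE. Qed.

Lemma siegel_formC (B : 'M[R]_n) V V' : siegel_form B V V' = siegel_form B V' V.
Proof.
by rewrite /siegel_form !linearD /=; congr (_ + _); rewrite mxtrace_mulC.
Qed.

Lemma fiber_formC (B : 'M[R]_n) u u' : B^T = B ->
  fiber_form B u u' = fiber_form B u' u.
Proof.
move=> sB; have tr00 (X : 'M[R]_1) : X 0 0 = X^T 0 0 by rewrite mxE.
rewrite /fiber_form tr00 linearD /= !trmx_mul !trmxK sB !mulmxA.
by [].
Qed.

(** Linearity holds over the reals only, hence the hypotheses on real and imaginary parts. *)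
Lemma siegel_formDl (B : 'M[R]_n) t V1 V2 V3 V' :
  re_mx V3 = t *: re_mx V1 + re_mx V2 -> im_mx V3 = t *: im_mx V1 + im_mx V2 ->
  siegel_form B V3 V' = t * siegel_form B V1 V' + siegel_form B V2 V'.
Proof.
rewrite /siegel_form => -> ->.
rewrite !mulmxDr !mulmxDl -!scalemxAr -!scalemxAl addrACA -scalerDr.
have tr_lin (X Y : 'M[R]_n) : \tr (t *: X + Y) = t * \tr X + \tr Y.
  by rewrite mxtraceD mxtraceZ.
exact: tr_lin.
Qed.

Lemma fiber_formDl (B : 'M[R]_n) t u1 u2 u3 u' :
  re_mx u3 = t *: re_mx u1 + re_mx u2 -> im_mx u3 = t *: im_mx u1 + im_mx u2 ->
  fiber_form B u3 u' = t * fiber_form B u1 u' + fiber_form B u2 u'.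
Proof.
rewrite /fiber_form => -> ->.
rewrite !mulmxDl -!scalemxAl addrACA -scalerDr.
by rewrite mxE [X in X + _]mxE.
Qed.

Lemma re_eta z w :
  re_mx (eta z w) = w.1.2 - z.2 *m invmx z.1.1.2 *m w.1.1.1.
Proof. exact: re_mkC. Qed.

Lemma im_eta z w : im_mx (eta z w) = w.2 - z.2 *m invmx z.1.1.2 *m w.1.1.2.
Proof. exact: im_mkC. Qed.

Lemma mulmx_affine (t : R) (r1 r2 P : 'rV[R]_n) (X1 X2 : 'M[R]_n) :
  t *: r1 + r2 - P *m (t *: X1 + X2) =
  t *: (r1 - P *m X1) + (r2 - P *m X2).
Proof. by rewrite mulmxDr -scalemxAr opprD addrACA -scalerBr. Qed.

Lemma row_coords_linear t (w1 w2 : E) :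
  [/\ (t *: w1 + w2).1.1.1 = t *: w1.1.1.1 + w2.1.1.1,
      (t *: w1 + w2).1.1.2 = t *: w1.1.1.2 + w2.1.1.2,
      (t *: w1 + w2).1.2 = t *: w1.1.2 + w2.1.2
    & (t *: w1 + w2).2 = t *: w1.2 + w2.2].
Proof. by []. Qed.

Lemma re_etaD z t w1 w2 : re_mx (eta z (t *: w1 + w2)) =
  t *: re_mx (eta z w1) + re_mx (eta z w2).
Proof. have [e1 e2 e3 e4] := row_coords_linear t w1 w2.
rewrite !re_eta e3 e1; exact: mulmx_affine. Qed.

Lemma im_etaD z t w1 w2 : im_mx (eta z (t *: w1 + w2)) =
  t *: im_mx (eta z w1) + im_mx (eta z w2).
Proof. have [e1 e2 e3 e4] := row_coords_linear t w1 w2.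
rewrite !im_eta e4 e2; exact: mulmx_affine. Qed.

Lemma re_vC (z : E) : re_mx (vC z) = z.1.1.1. Proof. exact: re_mkC. Qed.

Lemma im_vC (z : E) : im_mx (vC z) = z.1.1.2. Proof. exact: im_mkC. Qed.

Lemma sj_metricC alpha gamma z w w' : dom_xirho z ->
  sj_metric alpha gamma z w w' = sj_metric alpha gamma z w' w.
Proof.
move=> /dom_xirhoE[_ sy _]; rewrite /sj_metric siegel_formC fiber_formC //.
exact: invmx_sym.
Qed.

Lemma sj_metricDl alpha gamma z t w1 w2 w' :
  sj_metric alpha gamma z (t *: w1 + w2) w' =
  t * sj_metric alpha gamma z w1 w' + sj_metric alpha gamma z w2 w'.
Proof.
have ringE (s1 s2 f1 f2 : R) :
    alpha * (t * s1 + s2) + gamma * (t * f1 + f2) =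
    t * (alpha * s1 + gamma * f1) + (alpha * s2 + gamma * f2) by ring.
have reV : re_mx (vC (t *: w1 + w2)) = t *: re_mx (vC w1) + re_mx (vC w2).
  by have [e1 _ _ _] := row_coords_linear t w1 w2; rewrite !re_vC e1.
have imV : im_mx (vC (t *: w1 + w2)) = t *: im_mx (vC w1) + im_mx (vC w2).
  by have [_ e2 _ _] := row_coords_linear t w1 w2; rewrite !im_vC e2.
rewrite /sj_metric (siegel_formDl _ _ reV imV).
rewrite (fiber_formDl _ _ (re_etaD z t w1 w2) (im_etaD z t w1 w2)).
exact: ringE.
Qed.

Lemma sj_dpD z t w1 w2 :
  sj_dp z (t *: w1 + w2) = t *: sj_dp z w1 + sj_dp z w2.
Proof.
have E1 w : sj_dp z w = im_mx (eta z w) *m invmx (im_mx (vC z)) by [].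
by rewrite !E1 im_etaD mulmxDl -scalemxAl.
Qed.

Lemma sj_dqD z t w1 w2 :
  sj_dq z (t *: w1 + w2) = t *: sj_dq z w1 + sj_dq z w2.
Proof.
have E1 w : sj_dq z w = re_mx (eta z w) - sj_dp z w *m re_mx (vC z) by [].
rewrite !E1 re_etaD sj_dpD mulmxDl -scalemxAl opprD addrACA -scalerBr.
by [].
Qed.

Lemma sj_contactDl z t w1 w2 :
  sj_contact z (t *: w1 + w2) = t * sj_contact z w1 + sj_contact z w2.
Proof.
have ringE (k1 k2 f1 f2 g1 g2 : R) :
    t * k1 + k2 - (t * f1 + f2) + (t * g1 + g2) =
    t * (k1 - f1 + g1) + (k2 - f2 + g2) by ring.
have mx_lin (P r1 r2 : 'rV[R]_n) : (P *m (t *: r1 + r2)^T) 0 0 =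
    t * (P *m r1^T) 0 0 + (P *m r2^T) 0 0.
  have -> : (t *: r1 + r2)^T = t *: r1^T + r2^T.
    by apply/matrixP => i j; rewrite !mxE.
  by rewrite mulmxDr -scalemxAr mxE [X in X + _]mxE.
rewrite /sj_contact sj_dpD sj_dqD !mx_lin; exact: ringE.
Qed.

Lemma sj_metric_diag alpha gamma z w :
  sj_metric alpha gamma z w w =
  alpha * (\tr (invmx z.1.1.2 *m w.1.1.1 *m (invmx z.1.1.2 *m w.1.1.1))
           + \tr (invmx z.1.1.2 *m w.1.1.2 *m (invmx z.1.1.2 *m w.1.1.2)))
  + gamma * ((re_mx (eta z w) *m invmx z.1.1.2 *m (re_mx (eta z w))^T) 0 0
             + (im_mx (eta z w) *m invmx z.1.1.2 *m (im_mx (eta z w))^T) 0 0).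
Proof.
rewrite /sj_metric /siegel_form /fiber_form re_vC im_vC.
by rewrite -mxtraceD; congr (_ + _ * _); rewrite mxE.
Qed.

Lemma posdef_eq0 m (B : 'M[R]_m) (r : 'rV[R]_m) :
  posdef B -> (r *m B *m r^T) 0 0 = 0 -> r = 0.
Proof.
by move=> pB r0; apply/eqP; apply: contraT => /pB; rewrite r0 ltxx.
Qed.

Lemma weighted_sum_eq0 (al ga t1 t2 f1 f2 : R) : 0 < al -> 0 < ga ->
  0 <= t1 -> 0 <= t2 -> 0 <= f1 -> 0 <= f2 ->
  0 <= al * (t1 + t2) + ga * (f1 + f2) /\
  (al * (t1 + t2) + ga * (f1 + f2) = 0 ->
   [/\ t1 = 0, t2 = 0, f1 = 0 & f2 = 0]).
Proof.
move=> al0 ga0 t10 t20 f10 f20.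
have T : 0 <= al * (t1 + t2) by rewrite mulr_ge0 ?addr_ge0 // ltW.
have F : 0 <= ga * (f1 + f2) by rewrite mulr_ge0 ?addr_ge0 // ltW.
split; first exact: addr_ge0.
move/eqP; rewrite paddr_eq0 // !mulf_eq0 (gt_eqF al0) (gt_eqF ga0) /=.
rewrite !paddr_eq0 //.
by case/andP => /andP[/eqP ? /eqP ?] /andP[/eqP ? /eqP ?].
Qed.

(** A weighted sum of four nonnegative terms. If it vanishes, the trace terms give [dx = dy = 0];
    then [eta] is just [du], and the fiber terms give [du = 0]. The semidefinite half is kept
    separate for the extended metric. *)
Lemma sj_metric_posdef alpha gamma z w : 0 < alpha -> 0 < gamma ->
  dom_xirho z -> row_tangent w ->
  0 <= sj_metric alpha gamma z w w /\
  (sj_metric alpha gamma z w w = 0 -> w = 0).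
Proof.
move=> al0 ga0 /dom_xirhoE[sx sy py] /row_tangentE[sdx sdy].
have siy := invmx_sym sy; have piy := posdef_inv sy py.
rewrite sj_metric_diag.
have t10 := mxtrace_posdef_ge0 siy piy sdx.
have t20 := mxtrace_posdef_ge0 siy piy sdy.
have f10 := posdef_ge0 (re_mx (eta z w)) piy.
have f20 := posdef_ge0 (im_mx (eta z w)) piy.
have [ge0 eq0] := weighted_sum_eq0 al0 ga0 t10 t20 f10 f20.
split=> // /eq0[e1 e2 e3 e4].
have dx0 := mxtrace_posdef_eq0 siy piy sdx e1.
have dy0 := mxtrace_posdef_eq0 siy piy sdy e2.
have := posdef_eq0 piy e3; have := posdef_eq0 piy e4.
rewrite re_eta im_eta dx0 dy0 !mulmx0 !subr0.
clear -dx0 dy0.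
by case: w dx0 dy0 => [[[dx dy] dxi] drho] /= -> -> -> ->.
Qed.

Lemma eta0 z : eta z 0 = 0.
Proof.
rewrite /eta !mulmx0 !subr0.
by apply/matrixP => i j; rewrite mkC_coef !mxE.
Qed.

Lemma sj_contact0 z (k : R) : sj_contact z (0, k) = k.
Proof.
have r0 : re_mx (0 : 'rV[R[i]]_n) = 0 by apply/matrixP => i j; rewrite !mxE.
have i0 : im_mx (0 : 'rV[R[i]]_n) = 0 by apply/matrixP => i j; rewrite !mxE.
rewrite /sj_contact /sj_dq /q_of /sj_dp /p_of eta0 /= r0 i0 !mul0mx subr0 trmx0.
by rewrite !mulmx0 !mxE subr0 addr0.
Qed.

(** If both summands vanish, the first kills the base component of [w]; on such a vertical vector
    the contact form is [d kappa], which the second summand kills. *)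
Lemma sj_ext_metric_gt0 alpha gamma delta z w :
  0 < alpha -> 0 < gamma -> 0 < delta ->
  dom_xirho z.1 -> row_tangent w.1 -> w != 0 ->
  0 < sj_ext_metric alpha gamma delta z w w.
Proof.
move=> al0 ga0 de0 zA wV w0; rewrite /sj_ext_metric -expr2.
have [ge0 eq0] := sj_metric_posdef al0 ga0 zA wV.
have th0 : 0 <= delta * sj_contact z w ^+ 2 by rewrite mulr_ge0 ?sqr_ge0 ?ltW.
rewrite lt_neqAle addr_ge0 // andbT eq_sym paddr_eq0 //.
apply: contra w0 => /andP[/eqP/eq0]; case: w {wV ge0 eq0 th0} => w k /= ->.
by rewrite sj_contact0 mulf_eq0 (gt_eqF de0) /= sqrf_eq0 => /eqP ->.
Qed.

End metric.

(** * Smoothness of the metric coefficients *)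

Section smoothness.
Variables (R : realType) (n : nat).
Local Notation E := (row_coords R n).

(** An open set containing the domain. Without the symmetry constraint every direction is allowed,
    and all the coefficients involve no inverse other than that of [y]. *)
Definition unit_im : set E := [set z | z.1.1.2 \in unitmx].

Lemma line_open_unit_im : line_open setT unit_im.
Proof.
move=> z w uz _; have c : (h *: w + z).1.1.2 @[h --> (0 : R)^'] --> z.1.1.2.
  exact: cvg_line.
exact: near_unitmx uz c.
Qed.

Lemma dom_xirho_unit_im : dom_xirho (n := n) `<=` unit_im.
Proof. by move=> z /dom_xirhoE[_ _ /posdef_unit]. Qed.

Local Notation smx := (mx_Ck_on setT unit_im).
Let LO := line_open_unit_im.

Let fst_cvg (F G : normedModType R) (z : (F * G)%type) :
  fst x @[x --> z] --> z.1.
Proof. exact: (@cvg_fst _ _ (nbhs z.1) (nbhs z.2)). Qed.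

Let snd_cvg (F G : normedModType R) (z : (F * G)%type) :
  snd x @[x --> z] --> z.2.
Proof. exact: (@cvg_snd _ _ (nbhs z.1) (nbhs z.2)). Qed.

Let fst2_cvg (F G H : normedModType R) (z : (F * G * H)%type) :
  x.1.1 @[x --> z] --> z.1.1.
Proof.
exact: cvg_comp (@fst_cvg _ _ z) (@fst_cvg _ _ z.1).
Qed.

Lemma smx_x k : smx k (fun z : E => z.1.1.1).
Proof.
apply: mx_Ck_on_linear => [t u v|z] //.
exact: cvg_comp (@fst2_cvg _ _ _ z) (@fst_cvg _ _ z.1.1).
Qed.

Lemma smx_y k : smx k (fun z : E => z.1.1.2).
Proof.
apply: mx_Ck_on_linear => [t u v|z] //.
exact: cvg_comp (@fst2_cvg _ _ _ z) (@snd_cvg _ _ z.1.1).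
Qed.

Lemma smx_xi k : smx k (fun z : E => z.1.2).
Proof.
apply: mx_Ck_on_linear => [t u v|z] //.
exact: cvg_comp (@fst_cvg _ _ z) (@snd_cvg _ _ z.1).
Qed.

Lemma smx_rho k : smx k (fun z : E => z.2).
Proof. by apply: mx_Ck_on_linear => [t u v|z] //; exact: snd_cvg. Qed.

Lemma smx_iy k : smx k (fun z : E => invmx z.1.1.2).
Proof. by apply: (mx_Ck_on_inv LO) => [j|//]; exact: smx_y. Qed.

Lemma smxB m p k (M N : E -> 'M[R]_(m, p)) :
  smx k M -> smx k N -> smx k (fun z => M z - N z).
Proof. by move=> CM CN; apply: (mx_Ck_onD LO) => //; exact: (mx_Ck_onN LO). Qed.

Lemma smx_p k : smx k (@sj_p R n).
Proof.
rewrite (_ : @sj_p R n = fun z => z.2 *m invmx z.1.1.2); last first.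
  by apply/funext => z; rewrite sj_pE.
by apply: (mx_Ck_on_mul LO); [exact: smx_rho|exact: smx_iy].
Qed.

Lemma smx_q k : smx k (@sj_q R n).
Proof.
rewrite (_ : @sj_q R n = fun z => z.1.2 - sj_p z *m z.1.1.1); last first.
  by apply/funext => z; rewrite sj_qE.
apply: smxB; first exact: smx_xi.
by apply: (mx_Ck_on_mul LO); [exact: smx_p|exact: smx_x].
Qed.

Lemma smx_dp k w : smx k (fun z : E => sj_dp z w).
Proof.
under [X in smx k X]eq_fun do rewrite sj_dpE.
apply: (mx_Ck_on_mul LO); last exact: smx_iy.
apply: smxB; first exact: mx_Ck_on_cst.
by apply: (mx_Ck_on_mul LO); [exact: smx_p|exact: mx_Ck_on_cst].
Qed.

Lemma smx_dq k w : smx k (fun z : E => sj_dq z w).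
Proof.
under [X in smx k X]eq_fun do rewrite sj_dqE.
apply: smxB; last first.
  by apply: (mx_Ck_on_mul LO); [exact: smx_dp|exact: smx_x].
apply: smxB; first exact: mx_Ck_on_cst.
by apply: (mx_Ck_on_mul LO); [exact: smx_p|exact: mx_Ck_on_cst].
Qed.

Lemma Ck_sj_metric alpha gamma w1 w2 k :
  Ck_on setT unit_im k (fun z : E => sj_metric alpha gamma z w1 w2 : R^o).
Proof.
rewrite /sj_metric /siegel_form /fiber_form !re_mkC !im_mkC.
apply: (Ck_onD LO); apply: (Ck_onM LO); try exact: Ck_on_cst.
  apply: (Ck_on_sum LO) => i.
  have iyc (m : 'M[R]_n) : smx k (fun z : E => invmx z.1.1.2 *m m).
    by apply: (mx_Ck_on_mul LO); [exact: smx_iy|exact: mx_Ck_on_cst].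
  have := mx_Ck_onD LO (mx_Ck_on_mul LO (iyc w1.1.1.1) (iyc w2.1.1.1))
    (mx_Ck_on_mul LO (iyc w1.1.1.2) (iyc w2.1.1.2)).
  exact.
have er w : smx k (fun z : E => re_mx (eta z w)).
  under [X in smx k X]eq_fun do rewrite re_eta -sj_pE.
  apply: smxB; first exact: mx_Ck_on_cst.
  by apply: (mx_Ck_on_mul LO); [exact: smx_p|exact: mx_Ck_on_cst].
have ei w : smx k (fun z : E => im_mx (eta z w)).
  under [X in smx k X]eq_fun do rewrite im_eta -sj_pE.
  apply: smxB; first exact: mx_Ck_on_cst.
  by apply: (mx_Ck_on_mul LO); [exact: smx_p|exact: mx_Ck_on_cst].
have iy := smx_iy k.
have := mx_Ck_onD LO
  (mx_Ck_on_mul LO (mx_Ck_on_mul LO (er w1) iy) (mx_Ck_on_tr (er w2)))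
  (mx_Ck_on_mul LO (mx_Ck_on_mul LO (ei w1) iy) (mx_Ck_on_tr (ei w2))).
exact.
Qed.

End smoothness.

(** For the extended metric, whose coefficients do not depend on [kappa]: a directional derivative
    of a function of the first component is one of the original function along [w.1]. *)
Lemma Ck_on_fst (R : realType) (E F G : normedModType R) (V A : set E) k
    (f : E -> F) :
  Ck_on V A k f ->
  Ck_on [set w : (E * G)%type | V w.1] [set z : (E * G)%type | A z.1] k
    (fun z => f z.1).
Proof.
have cont (g : E -> F) : {within A, continuous g} ->
    {within [set z : (E * G)%type | A z.1], continuous (fun z => g z.1)}.
  move=> /subspace_continuousP cg; apply/subspace_continuousP => z Az B Bg.
  have := cg _ Az B Bg; rewrite /within /=.
  exact: (@cvg_fst _ _ (nbhs z.1) (nbhs z.2)).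
elim: k f => [|k IH] f [cf Hf]; split=> //; try exact: cont.
move=> w Vw; have [df Cf] := Hf _ Vw; split=> [z Az|]; first exact: df Az.
exact: IH Cf.
Qed.

(** * Derivatives of the change of coordinates and of the action *)

Section derivatives.
Variables (R : realType) (n : nat).
Local Notation E := (row_coords R n).

Lemma row_coords_eq (u v : E) : u.1.1.1 = v.1.1.1 -> u.1.1.2 = v.1.1.2 ->
  u.1.2 = v.1.2 -> u.2 = v.2 -> u = v.
Proof.
by case: u v => [[[? ?] ?] ?] [[[? ?] ?] ?] /= -> -> -> ->.
Qed.

Lemma mulmx_expand (P dP : 'rV[R]_n) (X dX : 'M[R]_n) (h : R) :
  (h *: dP + P) *m (h *: dX + X) =
  P *m X + h *: (dP *m X + P *m dX + h *: (dP *m dX)).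
Proof.
rewrite mulmxDl !mulmxDr -!scalemxAl -!scalemxAr !scalerDr !scalerA.
by rewrite addrC -!addrA addrC -!addrA; congr (_ + _); rewrite addrC !addrA.
Qed.

Lemma xirho_of_pqE (z : E) : xirho_of_pq z =
  (z.1.1.1, z.1.1.2, z.1.2 *m z.1.1.1 + z.2, z.1.2 *m z.1.1.2) :> E.
Proof.
case: z => [[[x y] p] q]; rewrite /xirho_of_pq /param_pq /coords_xirho /=.
rewrite -/(mkC x y) re_mkC im_mkC !cplx_mkC mkCM mkCD re_mkC im_mkC.
by rewrite !mul0mx subr0 !addr0.
Qed.

Definition d_xirho_of_pq (z w : E) : E :=
  (w.1.1.1, w.1.1.2, w.1.2 *m z.1.1.1 + z.1.2 *m w.1.1.1 + w.2,
   w.1.2 *m z.1.1.2 + z.1.2 *m w.1.1.2).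

Lemma is_derive_xirho_of_pq (z w : E) :
  is_derive z w (@xirho_of_pq R n) (d_xirho_of_pq z w).
Proof.
(* The parametrization is quadratic; these are its second-order terms, [dp dx] and [dp dy]. *)
pose q : E := (0, 0, w.1.2 *m w.1.1.1, w.1.2 *m w.1.1.2).
apply: (is_derive_quadratic (q := q)) => h; rewrite !xirho_of_pqE.
have [e1 e2 e3 e4] := row_coords_linear h w z.
rewrite e1 e2 e3 e4 !mulmx_expand; apply: row_coords_eq => /=.
- by rewrite scaler0 addr0 addrC.
- by rewrite scaler0 addr0 addrC.
- have reorder (A B C D Q : 'rV[R]_n) :
      A + h *: (B + h *: Q) + (h *: C + D) = A + D + h *: (B + C + h *: Q).
    by rewrite (addrC _ D) addrACA -scalerDr (addrAC B).
  exact: reorder.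
- by [].
Qed.

Lemma cvg_re_mulmx (T : Type) (F : set_system T) {FF : Filter F} (m p q : nat)
    (K : 'M[R[i]]_(m, p)) (X : T -> 'M[R[i]]_(p, q)) (L : 'M[R[i]]_(p, q)) :
  re_mx (X t) @[t --> F] --> re_mx L -> im_mx (X t) @[t --> F] --> im_mx L ->
  re_mx (K *m X t) @[t --> F] --> re_mx (K *m L) /\
  im_mx (K *m X t) @[t --> F] --> im_mx (K *m L).
Proof.
move=> reX imX; split.
  under eq_fun do rewrite re_mxM; rewrite re_mxM.
  by apply: cvgB; apply: cvg_mulmx => //; exact: cvg_cst.
under eq_fun do rewrite im_mxM; rewrite im_mxM.
by apply: cvgD; apply: cvg_mulmx => //; exact: cvg_cst.
Qed.

(** Insert [W_t D_t = 1]: [X0 D0 = X0 D0 (t W1 + W0) D_t = t X0 D0 W1 D_t + X0 D_t]. As [Dt] is any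
    right inverse, the explicit [act_den_inv] can be used for it. *)
Lemma right_quotient_increment (C : fieldType) m p (X0 X1 : 'M[C]_(m, p))
    (W0 W1 D0 Dt : 'M[C]_p) (t : C) :
  D0 *m W0 = 1%:M -> (t *: W1 + W0) *m Dt = 1%:M ->
  (t *: X1 + X0) *m Dt = X0 *m D0 + t *: ((X1 - X0 *m D0 *m W1) *m Dt).
Proof.
move=> D0W0 WtDt.
have XD : X0 *m D0 = t *: (X0 *m D0 *m W1 *m Dt) + X0 *m Dt.
  have XW : X0 *m D0 *m W0 = X0 by rewrite -mulmxA D0W0 mulmx1.
  rewrite -{1}[X0 *m D0]mulmx1 -WtDt mulmxA mulmxDr XW -scalemxAr.
  by rewrite mulmxDl -scalemxAl.
rewrite {1}XD mulmxDl mulmxBl scalerBr -scalemxAl.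
by rewrite addrAC addrCA subrr addr0 addrC.
Qed.

Lemma cvg_pair_normed (T : Type) (F : set_system T) {FF : Filter F}
    (G H : normedModType R) (f : T -> G) (g : T -> H) (a : G) (b : H) :
  f @ F --> a -> g @ F --> b ->
  ((f t, g t) : (G * H)%type) @[t --> F] --> ((a, b) : (G * H)%type).
Proof. exact: cvg_pair. Qed.

Lemma cvg_coords_xirho (T : Type) (F : set_system T) {FF : Filter F}
    (V : T -> 'M[R[i]]_n) (U : T -> 'rV[R[i]]_n) (v : 'M[R[i]]_n)
    (u : 'rV[R[i]]_n) :
  re_mx (V t) @[t --> F] --> re_mx v /\ im_mx (V t) @[t --> F] --> im_mx v ->
  re_mx (U t) @[t --> F] --> re_mx u /\ im_mx (U t) @[t --> F] --> im_mx u ->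
  (coords_xirho (V t, U t) : E) @[t --> F] --> (coords_xirho (v, u) : E).
Proof.
move=> [c1 c2] [c3 c4].
have H := cvg_pair_normed (cvg_pair_normed (cvg_pair_normed c1 c2) c3) c4.
exact: H.
Qed.

Lemma coords_xirhoD (t : R) (V V' : 'M[R[i]]_n) (U U' : 'rV[R[i]]_n) :
  coords_xirho (V + (t%:C)%C *: V', U + (t%:C)%C *: U') =
  coords_xirho (V, U) + t *: coords_xirho (V', U').
Proof.
apply: row_coords_eq => /=.
- by rewrite re_mxD re_mxZ.
- by rewrite im_mxD im_mxZ.
- by rewrite re_mxD re_mxZ.
- by rewrite im_mxD im_mxZ.
Qed.

(** Both components of the action are right quotients with the same denominator and with numerators
    affine in [(v, u)], so one increment identity serves for both. *)
Lemma act0_increment (M : 'M[R]_(n + n)) (l m : 'rV[R]_n) (t : R)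
    (v vt V Dt : 'M[R[i]]_n) (u ut U : 'rV[R[i]]_n) :
  let D := invmx (act_den M v) in
  vt = (t%:C)%C *: V + v -> ut = (t%:C)%C *: U + u ->
  act_den M v \in unitmx -> act_den M vt *m Dt = 1%:M ->
  coords_xirho (act_num M vt *m Dt, (ut + cplx_mx l *m vt + cplx_mx m) *m Dt) =
  coords_xirho (act_num M v *m D, (u + cplx_mx l *m v + cplx_mx m) *m D) +
  t *: coords_xirho (
    (cplx_mx (ulsubmx M) - act_num M v *m D *m cplx_mx (dlsubmx M)) *m V *m Dt,
    (U + (cplx_mx l - (u + cplx_mx l *m v + cplx_mx m) *m D
       *m cplx_mx (dlsubmx M)) *m V) *m Dt).
Proof.
move=> D vtE utE uD; rewrite /act_den vtE mulmxDr -scalemxAr -addrA => DtK.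
have DK : D *m (cplx_mx (dlsubmx M) *m v + cplx_mx (drsubmx M)) = 1%:M.
  by rewrite mulVmx.
have -> : act_num M ((t%:C)%C *: V + v) =
    (t%:C)%C *: (cplx_mx (ulsubmx M) *m V) + act_num M v.
  by rewrite /act_num mulmxDr -scalemxAr addrA.
have -> : ut + cplx_mx l *m ((t%:C)%C *: V + v) + cplx_mx m =
    (t%:C)%C *: (U + cplx_mx l *m V) + (u + cplx_mx l *m v + cplx_mx m).
  have reorder (s : R[i]) (A B C F G : 'rV[R[i]]_n) :
      s *: A + B + (s *: C + F) + G = s *: (A + C) + (B + F + G).
    by rewrite scalerDr addrACA -!addrA.
  by rewrite utE mulmxDr -scalemxAr; exact: reorder.
rewrite !(right_quotient_increment _ _ DK DtK) -coords_xirhoD.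
move: (act_num M v *m D) ((u + _ + _) *m D) => v1 u1.
have e1 : cplx_mx (ulsubmx M) *m V - v1 *m (cplx_mx (dlsubmx M) *m V) =
    (cplx_mx (ulsubmx M) - v1 *m cplx_mx (dlsubmx M)) *m V.
  by rewrite mulmxBl mulmxA.
have e2 : U + cplx_mx l *m V - u1 *m (cplx_mx (dlsubmx M) *m V) =
    U + (cplx_mx l - u1 *m cplx_mx (dlsubmx M)) *m V.
  by rewrite mulmxBl mulmxA addrA.
by rewrite e1 e2.
Qed.

Section action_derivative.
Variables (M : 'M[R]_(n + n)) (l m : 'rV[R]_n) (z w : E).
Hypotheses (SpM : Sp M) (zA : dom_xirho z) (wV : row_tangent w).

Local Notation D := (invmx (act_den M (vC z))).
Local Notation v1 := (act_num M (vC z) *m D).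
Local Notation u1 := ((uC z + cplx_mx l *m vC z + cplx_mx m) *m D).

Definition d_act0 : E :=
  coords_xirho ((cplx_mx (ulsubmx M) - v1 *m cplx_mx (dlsubmx M)) *m vC w *m D,
    (uC w + (cplx_mx l - u1 *m cplx_mx (dlsubmx M)) *m vC w) *m D).

Lemma act0E (x : E) : act0 (M, (l, m)) x =
  coords_xirho (act_num M (vC x) *m invmx (act_den M (vC x)),
    (uC x + cplx_mx l *m vC x + cplx_mx m) *m invmx (act_den M (vC x))).
Proof. by rewrite /act0 param_xirhoE. Qed.

Lemma vC_line (t : R) :
  vC (t *: w + z) = (t%:C)%C *: vC w + vC z.
Proof.
have [e1 e2 _ _] := row_coords_linear t w z.
by rewrite [LHS]/vC e1 e2 /vC mkCZ mkCD.
Qed.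

Lemma uC_line (t : R) :
  uC (t *: w + z) = (t%:C)%C *: uC w + uC z.
Proof.
have [_ _ e3 e4] := row_coords_linear t w z.
by rewrite [LHS]/uC e3 e4 /uC mkCZ mkCD.
Qed.

Let sx : z.1.1.1^T = z.1.1.1. Proof. by case/dom_xirhoE: zA. Qed.
Let sy : z.1.1.2^T = z.1.1.2. Proof. by case/dom_xirhoE: zA. Qed.
Let py : posdef z.1.1.2. Proof. by case/dom_xirhoE: zA. Qed.
Let uy : z.1.1.2 \in unitmx := posdef_unit py.
Let uS : act_gram M z.1.1.1 z.1.1.2 \in unitmx :=
  posdef_unit (act_gram_posdef SpM sx sy py).

Local Notation xt t := (t *: w.1.1.1 + z.1.1.1).
Local Notation yt t := (t *: w.1.1.2 + z.1.1.2).

Let cvg_x : xt t @[t --> (0 : R)^'] --> z.1.1.1. Proof. exact: cvg_line. Qed.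
Let cvg_y : yt t @[t --> (0 : R)^'] --> z.1.1.2. Proof. exact: cvg_line. Qed.

Let cvg_e : (dlsubmx M *m xt t + drsubmx M) @[t --> (0 : R)^'] -->
  dlsubmx M *m z.1.1.1 + drsubmx M.
Proof.
apply: cvgD; last exact: cvg_cst.
by apply: cvg_mulmx; [exact: cvg_cst|exact: cvg_x].
Qed.

Let cvg_iy : invmx (yt t) @[t --> (0 : R)^'] --> invmx z.1.1.2.
Proof. exact: cvg_invmx uy cvg_y. Qed.

Let cvg_gram : act_gram M (xt t) (yt t) @[t --> (0 : R)^'] -->
  act_gram M z.1.1.1 z.1.1.2.
Proof.
rewrite /act_gram; apply: cvgD.
  apply: cvg_mulmx; last by apply: cvg_trmx; exact: cvg_e.
  by apply: cvg_mulmx; [exact: cvg_e|exact: cvg_iy].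
apply: cvg_mulmx; last exact: cvg_cst.
by apply: cvg_mulmx; [exact: cvg_cst|exact: cvg_y].
Qed.

Let cvg_re_den : re_mx (act_den_inv M (xt t) (yt t)) @[t --> (0 : R)^'] -->
  re_mx (act_den_inv M z.1.1.1 z.1.1.2).
Proof.
rewrite /act_den_inv re_mkC; under eq_fun do rewrite re_mkC.
apply: cvg_mulmx; last exact: cvg_invmx uS cvg_gram.
by apply: cvg_mulmx; [exact: cvg_iy|apply: cvg_trmx; exact: cvg_e].
Qed.

Let cvg_im_den : im_mx (act_den_inv M (xt t) (yt t)) @[t --> (0 : R)^'] -->
  im_mx (act_den_inv M z.1.1.1 z.1.1.2).
Proof.
rewrite /act_den_inv im_mkC; under eq_fun do rewrite im_mkC.
apply: cvgN; apply: cvg_mulmx; first exact: cvg_cst.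
exact: cvg_invmx uS cvg_gram.
Qed.

(** Tangency of [w] keeps [x_t] and [y_t] symmetric, and invertibility of [y_t] and of the Gram
    matrix persists near 0; together these make the explicit inverse valid along the line. *)
Let near_den : \forall t \near (0 : R)^',
  act_den M (vC (t *: w + z)) *m act_den_inv M (xt t) (yt t) = 1%:M /\
  invmx (act_den M (vC (t *: w + z))) = act_den_inv M (xt t) (yt t).
Proof.
have [sdx sdy] := (row_tangentE w).1 wV.
near=> t.
have uyt : yt t \in unitmx by near: t; exact: near_unitmx uy cvg_y.
have uSt : act_gram M (xt t) (yt t) \in unitmx.
  by near: t; exact: near_unitmx uS cvg_gram.
have sxt : (xt t)^T = xt t by rewrite linearD /= linearZ /= sdx sx.
have syt : (yt t)^T = yt t by rewrite linearD /= linearZ /= sdy sy.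
have -> : vC (t *: w + z) = mkC (xt t) (yt t).
  by have [e1 e2 _ _] := row_coords_linear t w z; rewrite /vC e1 e2.
by split; [exact: act_denK|exact: invmx_act_den].
Unshelve. all: by end_near. Qed.

Lemma is_derive_act0 : is_derive z w (act0 (M, (l, m))) d_act0.
Proof.
pose K1 := (cplx_mx (ulsubmx M) - v1 *m cplx_mx (dlsubmx M)) *m vC w.
pose K2 := uC w + (cplx_mx l - u1 *m cplx_mx (dlsubmx M)) *m vC w.
pose Dt t := act_den_inv M (xt t) (yt t).
have DE : D = act_den_inv M z.1.1.1 z.1.1.2 by exact: invmx_act_den.
apply: (is_derive_quotient (q := fun t =>
  coords_xirho (K1 *m Dt t, K2 *m Dt t))); last first.
  have -> : d_act0 = coords_xirho (K1 *m act_den_inv M z.1.1.1 z.1.1.2,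
      K2 *m act_den_inv M z.1.1.1 z.1.1.2).
    by rewrite -DE.
  have c1 := cvg_re_mulmx K1 cvg_re_den cvg_im_den.
  have c2 := cvg_re_mulmx K2 cvg_re_den cvg_im_den.
  exact: (cvg_coords_xirho (V := fun t => K1 *m Dt t)
    (U := fun t => K2 *m Dt t) (c1 _) (c2 _)).
near=> t.
have [DtK DtE] : act_den M (vC (t *: w + z)) *m Dt t = 1%:M /\
  invmx (act_den M (vC (t *: w + z))) = Dt t by near: t; exact: near_den.
have uD : act_den M (vC z) \in unitmx by exact: act_den_unit.
have vE := vC_line t; have uE := uC_line t.
move: (t *: w + z) vE uE DtK DtE => zt vE uE DtK DtE.
rewrite [LHS]act0E.
rewrite DtE.
rewrite [X in _ = X + _]act0E.
exact: act0_increment.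
Unshelve. all: by end_near. Qed.

End action_derivative.

Lemma dom_pqE (z : E) : dom_pq z <-> dom_xirho (xirho_of_pq z).
Proof.
have e : param_xirho (xirho_of_pq z) = param_pq z.
  by rewrite param_xirhoE; exact: coords_xirhoK.
have -> : dom_xirho (xirho_of_pq z) =
    siegel_jacobi (param_xirho (xirho_of_pq z)) by [].
by rewrite e.
Qed.

End derivatives.

(** * Invariance under the Jacobi group *)

Section isometry.
Variables (R : realType) (n : nat) (M : 'M[R]_(n + n)) (l m : 'rV[R]_n).
Hypothesis SpM : Sp M.
Local Notation E := (row_coords R n).
Local Notation A := (cplx_mx (ulsubmx M)).
Local Notation C := (cplx_mx (dlsubmx M)).

(** Covariance of [du - p dv], with [P], [Q] the coordinates of the image. The coefficient of [dv]
    is [l - (P v1 + Q) c - P (a - v1 c) = l - P a - Q c = - p]. *)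
Lemma eta_increment (p P Q : 'rV[R]_n) (V v1 D : 'M[R[i]]_n)
    (U u1 : 'rV[R[i]]_n) :
  P *m ulsubmx M + Q *m dlsubmx M = p + l ->
  u1 = cplx_mx P *m v1 + cplx_mx Q ->
  (U + (cplx_mx l - u1 *m C) *m V) *m D
    - cplx_mx P *m ((A - v1 *m C) *m V *m D) =
  (U - cplx_mx p *m V) *m D.
Proof.
move=> PQ u1E.
have E1 : cplx_mx l - u1 *m C - cplx_mx P *m (A - v1 *m C) = - cplx_mx p.
  have -> : cplx_mx l = cplx_mx P *m A + cplx_mx Q *m C - cplx_mx p.
    by rewrite -!cplx_mxM -cplx_mxD PQ cplx_mxD addrC addKr.
  rewrite u1E mulmxBr mulmxDl mulmxA.
  move: (cplx_mx P *m A) (cplx_mx Q *m C) (cplx_mx P *m v1 *m C) => X Y Z.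
  by apply/matrixP => i j; rewrite !mxE; ring.
move: (A - v1 *m C) (cplx_mx l - u1 *m C) E1 => K K' E1.
by rewrite !mulmxA -mulmxBl -addrA -mulmxBl E1 mulNmx.
Qed.

(** Serves twice: for [u + l v + m], whose coordinates are [(p + l, q + m)], and for [eta], whose
    coordinates are [(dp, dq)]. The translation by [(l, m)] occurs only in the former. *)
Lemma act_pq_image (v : 'M[R[i]]_n) (p q : 'rV[R]_n) :
  act_den M v \in unitmx ->
  (cplx_mx p *m v + cplx_mx q) *m invmx (act_den M v) =
  cplx_mx (act_p M p q) *m (act_num M v *m invmx (act_den M v))
  + cplx_mx (act_q M p q).
Proof.
move=> uW; rewrite -(act_pq_complex SpM) mulmxDl -!mulmxA mulmxV // mulmx1.
by [].
Qed.

Section point.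
Variables (z : E).
Hypothesis zA : dom_xirho z.

Let sx : z.1.1.1^T = z.1.1.1. Proof. by case/dom_xirhoE: zA. Qed.
Let sy : z.1.1.2^T = z.1.1.2. Proof. by case/dom_xirhoE: zA. Qed.
Let py : posdef z.1.1.2. Proof. by case/dom_xirhoE: zA. Qed.
Let uy : z.1.1.2 \in unitmx := posdef_unit py.
Let S := act_gram M z.1.1.1 z.1.1.2.
Let sS : S^T = S := act_gram_sym M sx sy.
Let pS : posdef S := act_gram_posdef SpM sx sy py.
Let uS : S \in unitmx := posdef_unit pS.
Let uW : act_den M (vC z) \in unitmx := act_den_unit SpM sx sy py.

Local Notation D := (invmx (act_den M (vC z))).
Local Notation v1 := (act_num M (vC z) *m D).
Local Notation u1 := ((uC z + cplx_mx l *m vC z + cplx_mx m) *m D).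
Local Notation z1 := (act0 (M, (l, m)) z).

Let im_v1 : im_mx v1 = invmx S. Proof. exact: im_act. Qed.
Let uim_v1 : im_mx v1 \in unitmx. Proof. by rewrite im_v1 unitmx_inv. Qed.
Let uim_v : im_mx (vC z) \in unitmx. Proof. by rewrite im_vC. Qed.

Let z1E : z1 = coords_xirho (v1, u1). Proof. exact: act0E. Qed.

Let vC_z1 : vC z1 = v1.
Proof. by rewrite z1E; have [] := coords_xirhoK (v1, u1). Qed.

Let uC_z1 : uC z1 = u1.
Proof. by rewrite z1E; have [] := coords_xirhoK (v1, u1). Qed.

Lemma act0_dom : dom_xirho z1.
Proof.
apply/dom_xirhoE; rewrite -re_vC -im_vC vC_z1 -re_mxtr -im_mxtr.
have v1T : v1^T = v1 by exact: act_sym.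
by rewrite v1T im_v1; split=> //; exact: posdef_inv.
Qed.

Let u1E : u1 = cplx_mx (act_p M (sj_p z + l) (sj_q z + m)) *m v1
   + cplx_mx (act_q M (sj_p z + l) (sj_q z + m)).
Proof.
rewrite -act_pq_image //; congr (_ *m _).
rewrite -{1}(pq_ofK (uC z) uim_v) -/(sj_p z) -/(sj_q z) !cplx_mxD mulmxDl.
have reorder (X Y Z T : 'rV[R[i]]_n) : X + Y + Z + T = X + Z + (Y + T).
  by rewrite -(addrA (X + Y)) addrACA.
exact: reorder.
Qed.

Lemma sj_p_act : sj_p z1 = act_p M (sj_p z + l) (sj_q z + m).
Proof. by rewrite {1}/sj_p vC_z1 uC_z1 u1E; exact: p_of_pq. Qed.

Lemma sj_q_act : sj_q z1 = act_q M (sj_p z + l) (sj_q z + m).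
Proof. by rewrite {1}/sj_q vC_z1 uC_z1 u1E; exact: q_of_pq. Qed.

Local Notation dz1 w := (d_act0 M l m z w).

Let vC_dz1 w : vC (dz1 w) = (A - v1 *m C) *m vC w *m D.
Proof. by rewrite /d_act0; set K := (_, _); have [] := coords_xirhoK K. Qed.

Let uC_dz1 w : uC (dz1 w) = (uC w + (cplx_mx l - u1 *m C) *m vC w) *m D.
Proof. by rewrite /d_act0; set K := (_, _); have [] := coords_xirhoK K. Qed.

Lemma eta_act w : eta z1 (dz1 w) = eta z w *m D.
Proof.
rewrite !etaE -/(sj_p z1) -/(sj_p z) sj_p_act vC_dz1 uC_dz1.
apply: eta_increment (u1E); exact: act_pq_num.
Qed.

Let eta_actE w : eta z w *m D =
  cplx_mx (act_p M (sj_dp z w) (sj_dq z w)) *m v1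
  + cplx_mx (act_q M (sj_dp z w) (sj_dq z w)).
Proof. by rewrite -act_pq_image // /sj_dp /sj_dq pq_ofK. Qed.

Lemma sj_dp_act w : sj_dp z1 (dz1 w) = act_p M (sj_dp z w) (sj_dq z w).
Proof. by rewrite {1}/sj_dp vC_z1 eta_act eta_actE; exact: p_of_pq. Qed.

Lemma sj_dq_act w : sj_dq z1 (dz1 w) = act_q M (sj_dp z w) (sj_dq z w).
Proof. by rewrite {1}/sj_dq vC_z1 eta_act eta_actE; exact: q_of_pq. Qed.

(** At the image point the inverse imaginary part is [S], [dv] has become [D^T dv D] by the cocycle,
    and [eta] has become [eta D]; both forms are then unchanged by congruence. *)
Lemma sj_metric_act alpha gamma w w' :
  sj_metric alpha gamma z1 (dz1 w) (dz1 w') = sj_metric alpha gamma z w w'.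
Proof.
have DW : D *m act_den M (vC z) = 1%:M by rewrite mulVmx.
have SE := act_gram_complex SpM sx sy py.
have cocycle : A - v1 *m C = D^T by exact: act_cocycle.
have iy1 : invmx z1.1.1.2 = S by rewrite -im_vC vC_z1 im_v1 invmxK.
have e1 : siegel_form S (vC (dz1 w)) (vC (dz1 w')) =
    siegel_form (invmx z.1.1.2) (vC w) (vC w').
  have V1E a : vC (dz1 a) = D^T *m vC a *m D by rewrite vC_dz1 cocycle.
  apply: etrans (f_equal2 (siegel_form S) (V1E w) (V1E w')) _.
  exact: siegel_form_congr DW SE _ _.
have e2 : fiber_form S (eta z1 (dz1 w)) (eta z1 (dz1 w')) =
    fiber_form (invmx z.1.1.2) (eta z w) (eta z w').
  apply: etrans (f_equal2 (fiber_form S) (eta_act w) (eta_act w')) _.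
  exact: fiber_form_congr DW SE _ _.
have metricE (x a b : E) (B : 'M[R]_n) : invmx x.1.1.2 = B ->
    sj_metric alpha gamma x a b = alpha * siegel_form B (vC a) (vC b)
      + gamma * fiber_form B (eta x a) (eta x b).
  by move=> <-.
by rewrite (metricE z1 _ _ S iy1) e1 e2.
Qed.

(** The pairing of [(p + l, q + m)] with [(dp, dq)] is preserved. Its excess over the pairing with
    [(p, q)] is [l dq^t - m dp^t], exactly the term [th] that the action adds to [d kappa]. *)
Lemma sj_contact_act (kappa kappa1 dkappa : R) w :
  let th := (l *m (sj_dq z w)^T - m *m (sj_dp z w)^T) 0 0 in
  sj_contact (z1, kappa1) (dz1 w, dkappa + th) =
  sj_contact (z, kappa) (w, dkappa).
Proof.
move=> th; rewrite /sj_contact /= sj_p_act sj_q_act sj_dp_act sj_dq_act.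
rewrite /th; move: (sj_p z) (sj_q z) (sj_dp z w) (sj_dq z w) => p q dp dq.
have := act_pq_symplectic SpM (p + l) (q + m) dp dq.
move: (act_p _ _ _ *m _) (act_q _ _ _ *m _) => X Y.
rewrite !mulmxDl.
move: (p *m _) (l *m _) (q *m _) (m *m _) => B F G H.
move=> /matrixP/(_ 0 0); rewrite !mxE => e.
have -> : X 0 0 = B 0 0 + F 0 0 - (G 0 0 + H 0 0) + Y 0 0 by rewrite -e subrK.
ring.
Qed.

End point.
End isometry.

(** * The action on the coordinate kappa *)

Section extended_action.
Variables (R : realType) (n : nat).
Local Notation E := (row_coords R n).

(** Compare [rho_t y_t^-1] with [p = p y_t y_t^-1]: since [rho = p y], the difference is
    [t (drho - p dy) y_t^-1]. *)
Lemma p_increment (t : R) (rho drho p : 'rV[R]_n) (y dy iyt : 'M[R]_n) :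
  (t *: dy + y) *m iyt = 1%:M -> p *m y = rho ->
  (t *: drho + rho) *m iyt = p + t *: ((drho - p *m dy) *m iyt).
Proof.
move=> K <-.
have {2}-> : p = t *: (p *m dy *m iyt) + p *m y *m iyt.
  rewrite -{1}[p]mulmx1 -K mulmxDl mulmxDr -scalemxAl -scalemxAr.
  by rewrite !mulmxA.
rewrite mulmxDl mulmxBl scalerBr -scalemxAl.
by apply/matrixP => i j; rewrite !mxE; ring.
Qed.

Lemma q_increment (t : R) (xi dxi p dp : 'rV[R]_n) (x dx : 'M[R]_n) :
  t *: dxi + xi - (p + t *: dp) *m (t *: dx + x) =
  xi - p *m x + t *: (dxi - p *m dx - dp *m (t *: dx + x)).
Proof.
rewrite mulmxDl !mulmxDr -!scalemxAl -!scalemxAr.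
by apply/matrixP => i j; rewrite !mxE; ring.
Qed.

Section point.
Variables (z w : E).
Hypothesis uy : z.1.1.2 \in unitmx.

Let yt (t : R) := t *: w.1.1.2 + z.1.1.2.
Let xt (t : R) := t *: w.1.1.1 + z.1.1.1.
(** [dpt] and [dqt] are the exact difference quotients of [p] and [q] along the line. Their limits
    [sj_dp] and [sj_dq] are thereby the true differentials. *)
Let dpt t := (w.2 - sj_p z *m w.1.1.2) *m invmx (yt t).
Let dqt t := w.1.2 - sj_p z *m w.1.1.1 - dpt t *m xt t.

Let cvg_dpt : dpt t @[t --> (0 : R)^'] --> sj_dp z w.
Proof.
rewrite sj_dpE; apply: cvg_mulmx; first exact: cvg_cst.
by apply: cvg_invmx => //; exact: cvg_line.
Qed.

Let cvg_dqt : dqt t @[t --> (0 : R)^'] --> sj_dq z w.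
Proof.
rewrite sj_dqE; apply: cvgB; first exact: cvg_cst.
by apply: cvg_mulmx; [exact: cvg_dpt|exact: cvg_line].
Qed.

Let near_pq : \forall t \near (0 : R)^',
  sj_p (t *: w + z) = sj_p z + t *: dpt t /\
  sj_q (t *: w + z) = sj_q z + t *: dqt t.
Proof.
near=> t.
have uyt : yt t \in unitmx.
  near: t; apply: near_unitmx uy _; exact: cvg_line.
have [e1 e2 e3 e4] := row_coords_linear t w z.
move: (t *: w + z) e1 e2 e3 e4 => zt e1 e2 e3 e4.
have pE : sj_p zt = sj_p z + t *: dpt t.
  have pK : sj_p z *m z.1.1.2 = z.2 by rewrite sj_pE mulmxKV.
  rewrite (sj_pE zt) e4 e2; exact: p_increment (mulmxV uyt) pK.
by split=> //; rewrite (sj_qE zt) (sj_qE z) pE e3 e1; exact: q_increment.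
Unshelve. all: by end_near. Qed.

Definition kappa_act (l m : 'rV[R]_n) (k : R) (x : ext_coords R n) : R^o :=
  k + x.2 + (l *m (sj_q x.1)^T - m *m (sj_p x.1)^T) 0 0.

Lemma is_derive_kappa_act (l m : 'rV[R]_n) (k kappa dkappa : R) :
  is_derive ((z, kappa) : ext_coords R n) ((w, dkappa) : ext_coords R n)
    (kappa_act l m k)
    (dkappa + (l *m (sj_dq z w)^T - m *m (sj_dp z w)^T) 0 0).
Proof.
apply: (is_derive_quotient (q := fun t =>
  dkappa + (l *m (dqt t)^T - m *m (dpt t)^T) 0 0 : R^o)); last first.
  apply: cvgD; first exact: cvg_cst.
  apply: cvg_mx_coord; apply: cvgB; apply: cvg_mulmx; try exact: cvg_cst;
    by apply: cvg_trmx.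
near=> t.
have [pE qE] : sj_p (t *: w + z) = sj_p z + t *: dpt t /\
  sj_q (t *: w + z) = sj_q z + t *: dqt t by near: t; exact: near_pq.
rewrite /kappa_act.
have -> : (t *: ((w, dkappa) : ext_coords R n) + (z, kappa)).1 =
  t *: w + z by [].
have -> : (t *: ((w, dkappa) : ext_coords R n) + (z, kappa)).2 =
  t * dkappa + kappa by [].
have -> : ((z, kappa) : ext_coords R n).1 = z by [].
have -> : ((z, kappa) : ext_coords R n).2 = kappa by [].
rewrite pE qE.
move: (sj_p z) (sj_q z) (dpt t) (dqt t) => p q dp dq.
have sub00 (X Y : 'M[R]_1) : (X - Y) 0 0 = X 0 0 - Y 0 0 by rewrite !mxE.
have lin00 (a r dr : 'rV[R]_n) :
    (a *m (r + t *: dr)^T) 0 0 = (a *m r^T) 0 0 + t * (a *m dr^T) 0 0.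
  have -> : (r + t *: dr)^T = r^T + t *: dr^T.
    by apply/matrixP => i j; rewrite !mxE.
  by rewrite mulmxDr -scalemxAr mxE [X in _ + X]mxE.
rewrite !sub00 !lin00 /GRing.scale /=; ring.
Unshelve. all: by end_near. Qed.

End point.
End extended_action.

(** The value 0 for [kappa] is a placeholder, as the coefficients of the contact form depend on the
    base point alone. *)
Lemma Ck_sj_contact (R : realType) (n : nat) (w : ext_coords R n) k :
  Ck_on setT (@unit_im R n) k (fun z => sj_contact (z, 0) w : R^o).
Proof.
have LO := @line_open_unit_im R n; rewrite /sj_contact /=.
have CN (f : row_coords R n -> R^o) : Ck_on setT (@unit_im R n) k f ->
    Ck_on setT (@unit_im R n) k (fun z => - f z : R^o).
  move=> Cf; under [X in Ck_on _ _ _ X]eq_fun do rewrite -mulN1r.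
  by apply: (Ck_onM LO) => //; exact: Ck_on_cst.
apply: (Ck_onD LO).
  apply: (Ck_onD LO); first exact: Ck_on_cst.
  apply: CN.
  exact: (mx_Ck_on_mul LO (@smx_p R n k) (mx_Ck_on_tr (@smx_dq R n k w.1)) 0 0).
exact: (mx_Ck_on_mul LO (@smx_q R n k) (mx_Ck_on_tr (@smx_dp R n k w.1)) 0 0).
Qed.

(** * The metrics are Riemannian and invariant *)

Section riemannian.
Variables (R : realType) (n : nat).

Lemma sj_metric_riemannian (alpha gamma : R) : 0 < alpha -> 0 < gamma ->
  riemannian_metric (@row_tangent R n) (@dom_xirho R n)
    (sj_metric alpha gamma).
Proof.
move=> al0 ga0; split.
- by move=> z w1 w2 zA _ _; exact: sj_metricC.
- by move=> z t w1 w2 w3 _ _ _ _; exact: sj_metricDl.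
- move=> z w zA wV w0; have [ge0 eq0] := sj_metric_posdef al0 ga0 zA wV.
  by rewrite lt_neqAle ge0 andbT eq_sym; apply: contra w0 => /eqP/eq0 ->.
- move=> w1 w2 _ _ k; apply: Ck_on_sub (Ck_sj_metric alpha gamma w1 w2 k) => //.
  exact: dom_xirho_unit_im.
Qed.

Lemma sj_ext_metric_riemannian (alpha gamma delta : R) :
  0 < alpha -> 0 < gamma -> 0 < delta ->
  riemannian_metric (@ext_tangent R n) (@ext_dom_xirho R n)
    (sj_ext_metric alpha gamma delta).
Proof.
move=> al0 ga0 de0; split.
- move=> z w1 w2 zA _ _.
  have combine (f f' c c' : R) : f = f' ->
      f + delta * (c * c') = f' + delta * (c' * c).
    by move=> ->; rewrite (mulrC c).
  exact: combine (sj_metricC alpha gamma w1.1 w2.1 zA).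
- move=> z t w1 w2 w3 _ _ _ _.
  have combine (f f1 f2 c c1 c2 c3 : R) : f = t * f1 + f2 -> c = t * c1 + c2 ->
      f + delta * (c * c3) =
      t * (f1 + delta * (c1 * c3)) + (f2 + delta * (c2 * c3)).
    by move=> -> ->; ring.
  exact: combine (sj_metricDl alpha gamma z.1 t w1.1 w2.1 w3.1)
    (sj_contactDl z t w1 w2).
- by move=> z w zA wV w0; exact: sj_ext_metric_gt0.
- move=> w1 w2 _ _ k.
  have LO := @line_open_unit_im R n.
  have H : Ck_on setT (@unit_im R n) k (fun z =>
      sj_metric alpha gamma z w1.1 w2.1
      + delta * (sj_contact (z, 0) w1 * sj_contact (z, 0) w2) : R^o).
    apply: (Ck_onD LO); first exact: Ck_sj_metric.
    apply: (Ck_onM LO); first exact: Ck_on_cst.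
    by apply: (Ck_onM LO); exact: Ck_sj_contact.
  (* [sj_contact] reads only the base component of the point, so [(z.1, 0)] stands for [z]. *)
  apply: Ck_on_sub (@Ck_on_fst _ _ R^o _ _ _ _ _ H) => //.
  by move=> z /dom_xirho_unit_im.
Qed.

Lemma sj_metric_isometry (alpha gamma : R) h : GJ0 h ->
  isometry_on (@row_tangent R n) (@dom_xirho R n) (sj_metric alpha gamma)
    (act0 h).
Proof.
case: h => M [l m] SpM; split.
- by move=> z; exact: act0_dom.
- by move=> z w zA wV; have [] := is_derive_act0 l m SpM zA wV.
- move=> z w1 w2 zA w1V w2V; rewrite /pullback.
  have [_ ->] := is_derive_act0 l m SpM zA w1V.
  have [_ ->] := is_derive_act0 l m SpM zA w2V.
  exact: sj_metric_act.
Qed.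

Lemma ext_actE (M : 'M[R]_(n + n)) (l m : 'rV[R]_n) (k : R)
    (z : ext_coords R n) :
  ext_act (M, (l, m), k) z = (act0 (M, (l, m)) z.1, kappa_act l m k z).
Proof.
by rewrite /kappa_act /sj_q /sj_p -param_xirhoE.
Qed.

Lemma is_derive_ext_act (M : 'M[R]_(n + n)) (l m : 'rV[R]_n) (k : R)
    (z w : ext_coords R n) :
  Sp M -> dom_xirho z.1 -> row_tangent w.1 ->
  is_derive z w (ext_act (M, (l, m), k)) (d_act0 M l m z.1 w.1,
    w.2 + (l *m (sj_dq z.1 w.1)^T - m *m (sj_dp z.1 w.1)^T) 0 0).
Proof.
case: z w => [z kappa] [w dkappa] SpM zA wV.
have -> : ext_act (M, (l, m), k) =
    fun x => (act0 (M, (l, m)) x.1, kappa_act l m k x).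
  by apply/funext => x; exact: ext_actE.
apply: is_derive_pair.
  exact: (is_derive_fst (is_derive_act0 l m SpM zA wV)).
exact: is_derive_kappa_act (dom_xirho_unit_im zA) _ _ _ _ _.
Qed.

Lemma sj_ext_metric_isometry (alpha gamma delta : R) h : GJ h ->
  isometry_on (@ext_tangent R n) (@ext_dom_xirho R n)
    (sj_ext_metric alpha gamma delta) (ext_act h).
Proof.
case: h => [[M [l m]] k] SpM; split.
- by move=> z zA; rewrite ext_actE; exact: act0_dom.
- by move=> z w zA wV; have [] := is_derive_ext_act l m k SpM zA wV.
- move=> z w1 w2 zA w1V w2V; rewrite /pullback.
  have [_ ->] := is_derive_ext_act l m k SpM zA w1V.
  have [_ ->] := is_derive_ext_act l m k SpM zA w2V.
  rewrite ext_actE.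
  case: z w1 w2 zA w1V w2V => [z kappa] [w1 dk1] [w2 dk2] zA w1V w2V.
  rewrite /sj_ext_metric.
  have c1 := sj_contact_act l m SpM zA kappa
    (kappa_act l m k (z, kappa)) dk1 w1.
  have c2 := sj_contact_act l m SpM zA kappa
    (kappa_act l m k (z, kappa)) dk2 w2.
  have e := sj_metric_act l m SpM zA alpha gamma w1 w2.
  have combine (f f' a a' b b' : R) : f = f' -> a = a' -> b = b' ->
    f + delta * (a * b) = f' + delta * (a' * b') by move=> -> -> ->.
  exact: combine e c1 c2.
Qed.

End riemannian.

(** * The metrics in the coordinate systems *)

Section expressions.
Variables (R : realType) (n : nat).
Local Notation E := (row_coords R n).

Lemma trmx11 (X : 'M[R]_1) : X^T = X.
Proof. by apply/matrixP => i j; rewrite mxE !ord1. Qed.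

Lemma bilin_formC (B : 'M[R]_n) (X Y : 'rV[R]_n) : B^T = B ->
  Y *m B *m X^T = X *m B *m Y^T.
Proof. by move=> sB; rewrite -[LHS]trmx11 !trmx_mul trmxK sB mulmxA. Qed.

Lemma quad_formD (B : 'M[R]_n) (X Y : 'rV[R]_n) : B^T = B ->
  (X + Y) *m B *m (X + Y)^T =
  X *m B *m X^T + Y *m B *m Y^T + 2 *: (X *m B *m Y^T).
Proof.
move=> sB.
have -> : (X + Y)^T = X^T + Y^T by apply/matrixP => i j; rewrite !mxE.
rewrite !mulmxDl !mulmxDr (bilin_formC _ _ sB).
by apply/matrixP => i j; rewrite !mxE; ring.
Qed.

Lemma quad_formB (B : 'M[R]_n) (X Y : 'rV[R]_n) : B^T = B ->
  (X - Y) *m B *m (X - Y)^T =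
  X *m B *m X^T + Y *m B *m Y^T - 2 *: (Y *m B *m X^T).
Proof.
move=> sB; rewrite quad_formD //.
have -> : (- Y)^T = - Y^T by apply/matrixP => i j; rewrite !mxE.
by rewrite !mulNmx !mulmxN opprK (bilin_formC X Y sB) scalerN.
Qed.

(** The left side is the fiber form at [eta = dp v + dq], whose real and imaginary parts are
    [dp x + dq] and [dp y]. *)
Lemma fiber_pq (x y iy : 'M[R]_n) (dp dq : 'rV[R]_n) :
  x^T = x -> y^T = y -> iy^T = iy ->
  ((dp *m x + dq) *m iy *m (dp *m x + dq)^T) 0 0
  + (dp *m y *m iy *m (dp *m y)^T) 0 0 =
  (dp *m (x *m iy *m x + y *m iy *m y) *m dp^T + dq *m iy *m dq^T
   + 2 *: (dp *m x *m iy *m dq^T)) 0 0.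
Proof.
move=> sx sy siy; rewrite quad_formD // !trmx_mul sx sy mulmxDr mulmxDl !mulmxA.
rewrite !mxE; ring.
Qed.

(** With [xi = p x + q] and [rho = p y], the terms [p dx] and [p dy] of [du] cancel against [p dv]
    in [eta], leaving [dp v + dq]. *)
Lemma sj_metric_pq (alpha gamma : R) (z w : E) : dom_pq z ->
  sj_metric alpha gamma (xirho_of_pq z) (d_xirho_of_pq z w) (d_xirho_of_pq z w)
  = ds2_pq alpha gamma z w.
Proof.
move=> /dom_pqE/dom_xirhoE; rewrite xirho_of_pqE sj_metric_diag.
case: z w => [[[x y] p] q] [[[dx dy] dp] dq] /= [sx sy /posdef_unit uy].
rewrite /ds2_siegel mxtraceD re_eta im_eta /= mulmxK //.
have siy := invmx_sym sy.
rewrite -fiber_pq //; congr (_ + _ * (_ + _)).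
  by rewrite (addrAC (dp *m x)) addrK.
by rewrite addrK.
Qed.

(** The squares of [dxi - rho y^-1 dx] and [drho - rho y^-1 dy] are expanded; symmetry of [y^-1]
    merges the two cross terms of each. *)
Lemma sj_metric_xirho (alpha gamma : R) (z w : E) : dom_xirho z ->
  sj_metric alpha gamma z w w = ds2_xirho alpha gamma z w.
Proof.
move=> /dom_xirhoE; rewrite sj_metric_diag.
case: z w => [[[x y] xi] rho] [[[dx dy] dxi] drho] /= [sx sy py].
have siy := invmx_sym sy.
rewrite /ds2_siegel mxtraceD re_eta im_eta /= !quad_formB //.
congr (_ + _ * _).
by rewrite !mxE; ring.
Qed.

Lemma is_derive_ext_xirho_of_pq (z w : ext_coords R n) :
  is_derive z w (@ext_xirho_of_pq R n)
    ((d_xirho_of_pq z.1 w.1, w.2) : ext_coords R n).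
Proof.
apply: (@is_derive_pair R (ext_coords R n) E R^o
  (fun x : ext_coords R n => xirho_of_pq x.1) (fun x => x.2)).
  exact: (is_derive_fst (is_derive_xirho_of_pq z.1 w.1)).
apply: (is_derive_quotient (q := fun=> w.2 : R^o)); last exact: cvg_cst.
by near=> h; rewrite addrC.
Unshelve. all: by end_near. Qed.

Lemma sj_contact_pq (z w : ext_coords R n) : dom_pq z.1 ->
  sj_contact ((xirho_of_pq z.1, z.2) : ext_coords R n)
    ((d_xirho_of_pq z.1 w.1, w.2) : ext_coords R n) = contact_form z w.
Proof.
move=> /dom_pqE/dom_xirhoE; rewrite xirho_of_pqE.
case: z w => [[[[x y] p] q] kappa] [[[[dx dy] dp] dq] dkappa] /=.
move=> [sx sy /posdef_unit uy]; rewrite /sj_contact /=.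
rewrite sj_dqE sj_dpE sj_qE sj_pE /= mulmxK // addrK mulmxK //.
rewrite (addrC (p *m x)) addrK (addrAC (dp *m x)) addrK.
by rewrite (addrC (dp *m x)) addrK.
Qed.

End expressions.

(** For the coordinates [(chi, psi)], which differ from [(p, q)] by a linear rearrangement: a linear
    map sends lines to lines, so difference quotients correspond exactly. *)
Lemma is_derive_comp_linear (R : realType) (E F G : normedModType R)
    (tau : E -> F) (f : F -> G) (z w : E) (l : G) :
  (forall h, tau (h *: w + z) = h *: tau w + tau z) ->
  is_derive (tau z) (tau w) f l -> is_derive z w (f \o tau) l.
Proof.
move=> lin df.
have e : (fun h : R => h^-1 *: ((f \o tau) (h *: w + z) - (f \o tau) z)) =
    (fun h => h^-1 *: (f (h *: tau w + tau z) - f (tau z))).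
  by apply/funext => h; rewrite /= lin.
case: df => df <-; split; first by move: df; rewrite /derivable /= e.
by rewrite /derive /= e.
Qed.

Section coordinates.
Variables (R : realType) (n : nat).

(** The order is swapped because [chi = q^t] precedes [psi = p^t]. *)
Definition row_of_col (z : col_coords R n) : row_coords R n :=
  (z.1.1.1, z.1.1.2, z.2^T, z.1.2^T).

Lemma xirho_of_chipsiE (z : col_coords R n) :
  xirho_of_chipsi z = xirho_of_pq (row_of_col z).
Proof. by case: z => [[[x y] chi] psi]. Qed.

Lemma dom_chipsiE (z : col_coords R n) : dom_chipsi z <-> dom_pq (row_of_col z).
Proof. by case: z => [[[x y] chi] psi]. Qed.

Lemma ds2_chipsiE alpha gamma (z w : col_coords R n) :
  ds2_chipsi alpha gamma z w = ds2_pq alpha gamma (row_of_col z) (row_of_col w).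
Proof.
case: z w => [[[x y] chi] psi] [[[dx dy] dchi] dpsi].
by rewrite /row_of_col /ds2_pq /= !trmxK.
Qed.

Lemma is_derive_xirho_of_chipsi (z w : col_coords R n) :
  is_derive z w (@xirho_of_chipsi R n)
    (d_xirho_of_pq (row_of_col z) (row_of_col w)).
Proof.
have -> : @xirho_of_chipsi R n = @xirho_of_pq R n \o row_of_col.
  by apply/funext => x; exact: xirho_of_chipsiE.
apply: is_derive_comp_linear (is_derive_xirho_of_pq _ _) => h.
by apply: row_coords_eq => //=; apply/matrixP => i j; rewrite !mxE.
Qed.

Lemma sj_expressed_pq alpha gamma :
  expressed_as (@row_tangent R n) (@dom_pq R n) (@xirho_of_pq R n)
    (sj_metric alpha gamma) (ds2_pq alpha gamma).
Proof.
split=> z w zA _; have [d e] := is_derive_xirho_of_pq z w; first exact: d.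
by rewrite /pullback e; exact: sj_metric_pq.
Qed.

Lemma sj_expressed_chipsi alpha gamma :
  expressed_as (@col_tangent R n) (@dom_chipsi R n) (@xirho_of_chipsi R n)
    (sj_metric alpha gamma) (ds2_chipsi alpha gamma).
Proof.
split=> z w zA _; have [d e] := is_derive_xirho_of_chipsi z w; first exact: d.
rewrite /pullback e xirho_of_chipsiE ds2_chipsiE.
by apply: sj_metric_pq; apply/dom_chipsiE.
Qed.

Lemma sj_expressed_xirho alpha gamma :
  expressed_as (@row_tangent R n) (@dom_xirho R n) (@xirho_of_xirho R n)
    (sj_metric alpha gamma) (ds2_xirho alpha gamma).
Proof.
have -> : @xirho_of_xirho R n = id.
  apply/funext => z; rewrite /xirho_of_xirho param_xirhoE.
  by apply: row_coords_eq; rewrite /= ?re_mkC ?im_mkC.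
split=> z w zA _; first exact: derivable_id.
by rewrite /pullback derive_id; exact: sj_metric_xirho.
Qed.

Lemma sj_ext_metric_pq alpha gamma delta (z w : ext_coords R n) :
  ext_dom_pq z ->
  pullback (@ext_xirho_of_pq R n) (sj_ext_metric alpha gamma delta) z w w =
  ds2_pq alpha gamma z.1 w.1 + delta * contact_form z w ^+ 2.
Proof.
move=> zA; have [_ e] := is_derive_ext_xirho_of_pq z w.
rewrite /pullback e expr2 -(sj_metric_pq alpha gamma w.1 zA).
by rewrite -(sj_contact_pq w zA).
Qed.

End coordinates.

Theorem theorem1 (R : realType) (n : nat) (n_gt0 : (0 < n)%N)
    (alpha gamma delta : R)
    (alpha_gt0 : 0 < alpha) (gamma_gt0 : 0 < gamma) (delta_gt0 : 0 < delta) :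
  exists g : row_coords R n -> row_coords R n -> row_coords R n -> R,
    [/\ riemannian_metric (@row_tangent R n) (@dom_xirho R n) g,
        forall h, GJ0 h ->
          isometry_on (@row_tangent R n) (@dom_xirho R n) g (act0 h),
        expressed_as (@row_tangent R n) (@dom_pq R n)
          (@xirho_of_pq R n) g (ds2_pq alpha gamma),
        expressed_as (@col_tangent R n) (@dom_chipsi R n)
          (@xirho_of_chipsi R n) g (ds2_chipsi alpha gamma)
      & expressed_as (@row_tangent R n) (@dom_xirho R n)
          (@xirho_of_xirho R n) g (ds2_xirho alpha gamma)] /\
    exists gt : ext_coords R n -> ext_coords R n -> ext_coords R n -> R,
      [/\ riemannian_metric (@ext_tangent R n) (@ext_dom_xirho R n) gt,
          forall h, GJ h ->
            isometry_on (@ext_tangent R n) (@ext_dom_xirho R n) gt (ext_act h),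
          expressed_as (@ext_tangent R n) (@ext_dom_pq R n)
            (@ext_xirho_of_pq R n) gt
            (fun z dz => pullback (@xirho_of_pq R n) g z.1 dz.1 dz.1
                         + delta * contact_form z dz ^+ 2)
        & expressed_as (@ext_tangent R n) (@ext_dom_pq R n)
            (@ext_xirho_of_pq R n) gt (ds2_ext alpha gamma delta)].
Proof.
have d_ext z w : derivable (@ext_xirho_of_pq R n) z w.
  by have [] := is_derive_ext_xirho_of_pq z w.
exists (sj_metric alpha gamma); split.
  split; [exact: sj_metric_riemannian|exact: sj_metric_isometry|
    exact: sj_expressed_pq|exact: sj_expressed_chipsi|
    exact: sj_expressed_xirho].
exists (sj_ext_metric alpha gamma delta).
split; [exact: sj_ext_metric_riemannian|exact: sj_ext_metric_isometry| |].
- split=> [z w _ _|z w zA wV]; first exact: d_ext.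
  (* Both displayed forms of the extended metric are the same expression in [(p, q)]; here the base
     metric enters as a pullback and is first identified with [ds2_pq]. *)
  have [_ g_pq] := @sj_expressed_pq R n alpha gamma.
  by rewrite (g_pq _ _ zA wV) sj_ext_metric_pq.
- split=> [z w _ _|z w zA wV]; first exact: d_ext.
  rewrite sj_ext_metric_pq //.
  by case: z w {zA wV} => [[[[x y] p] q] kappa] [[[[dx dy] dp] dq] dkappa].
Qed.
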